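(* Let $\mathsf R$ be a multivariate Ore extension of a domain $R$ and let $F\subset\mathsf R^m\setminus\{0\}$ be any set. Fix one of the four settings left, right, bilateral, restricted. Let $\mathbb I(F)$ be the corresponding module generated by $F$, and consider the following conditions (all notions being those of the fixed setting): (1) $f\in\mathbb I(F)$ iff it has a strong Gröbner representation $f=\sum_{i=1}^\mu a_i\lambda_i\star g_i\star b_i\rho_i$ in terms of $F$ which further satisfies $\mathbf T(f)=\mathbf T(\lambda_1\star g_1\star\rho_1)>\cdots>\mathbf T(\lambda_i\star g_i\star\rho_i)>\cdots$; (2) $f\in\mathbb I(F)$ iff it has a strong Gröbner representation in terms of $F$; (3) $F$ is a strong Gröbner basis of $\mathbb I(F)$; (4) $f\in\mathbb I(F)$ iff it has a weak Gröbner representation in terms of $F$; (5) $F$ is a (weak) Gröbner basis of $\mathbb I(F)$; (6) (left and right settings) $f\in\mathbb I(F)$ iff it has a Gröbner representation in terms of $F$; (7) for each $f\in\mathsf R^m\setminus\{0\}$ and any strong normal form $h$ of $f$ w.r.t. $F$: $f\in\mathbb I(F)\iff h=0$; (8) for each $f\in\mathsf R^m\setminus\{0\}$ and any weak normal form $h$ of $f$ w.r.t. $F$: $f\in\mathbb I(F)\iff h=0$. Then the following implications hold: $(1)\Leftrightarrow(2)\Rightarrow(4)\Leftrightarrow(6)$, $(2)\Leftrightarrow(3)$, $(3)\Rightarrow(7)\Rightarrow(2)$, $(3)\Rightarrow(5)$, $(4)\Leftrightarrow(5)$, $(5)\Rightarrow(8)\Rightarrow(4)$. If $R$ is a skew field,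 then also $(4)\Rightarrow(2)$ and, as a consequence, $(5)\Rightarrow(3)$.
   Context: **Ore extensions.** $R$ is a (not necessarily commutative) domain with identity. A multivariate Ore extension $\mathsf R=R[Y_1;\alpha_1,\delta_1]\cdots[Y_n;\alpha_n,\delta_n]$ is an iterated Ore extension ($Y_i\star r=\alpha_i(r)Y_i+\delta_i(r)$, $\alpha_i$ an injective ring endomorphism mapping $R$ to $R$, $\delta_i$ an $\alpha_i$-derivation mapping $R$ to $R$, i.e. additive with $\delta_i(rr')=\alpha_i(r)\delta_i(r')+\delta_i(r)r'$) such that $\alpha_j\delta_i=\delta_i\alpha_j$ for $i\ne j$, $\alpha_i\alpha_j=\alpha_j\alpha_i$, $\delta_i\delta_j=\delta_j\delta_i$, and $\alpha_j(Y_i)=Y_i$, $\delta_j(Y_i)=0$ for $i<j$. Its multiplication is $\star$. It is a free left $R$-module on the terms $\mathcal T=\{Y_1^{a_1}\cdots Y_n^{a_n}\}$, a commutative monoid with product $\circ$. For $\tau=Y_1^{a_1}\cdots Y_n^{a_n}$, $\alpha_\tau=\alpha_1^{a_1}\cdots\alpha_n^{a_n}$. The associated graded ring has the same left $R$-module structure with product $(a\tau)\ast(b\omega)=a\alpha_\tau(b)\,\tau\circ\omega$. **Orderings.** $\mathsf R^m$ has canonical basis $\mathbf e_i$ (with $r\star(s\mathbf e_i)\star t=(r\star s\star t)\mathbf e_i$) and terms $\mathcal T^{(m)}=\{t\mathbf e_i\}$. Fix a term ordering $\prec$ on $\mathcal T$ and a compatible term ordering $<$ on $\mathcal T^{(m)}$: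 a well-ordering with $\omega_1\prec\omega_2\Rightarrow\omega_1t<\omega_2t$ and $t_1<t_2\Rightarrow\omega t_1<\omega t_2$. $\mathbf T(f)$, $\mathrm{lc}(f)$, $\mathbf M(f)=\mathrm{lc}(f)\mathbf T(f)$: maximal term, leading coefficient, maximal monomial. **The four settings.** Consider products $a\lambda\star g\star b\rho$ with $a,b\in R\setminus\{0\}$, $\lambda,\rho\in\mathcal T$, $g\in F$. Bilateral: all are allowed; left: $b=1,\rho=1$; right: $a=1,\lambda=1$; restricted: $\lambda=1,b=1$ (products $a\,g\star\rho$). $\mathbb I(F)$ is the set of all finite sums of allowed products (left, right, bilateral module generated by $F$; in the restricted case the left $R$-span of the $g\star\rho$). In each setting, with only allowed products: - weak Gröbner representation of $f$: $f=\sum_ia_i\lambda_i\star g_i\star b_i\rho_i$ with $\lambda_i\circ\mathbf T(g_i)\circ\rho_i\le\mathbf T(f)$ for all $i$; - strong Gröbner representation: $f=\sum_ia_i\lambda_i\star g_i\star b_i\rho_i$ with $\mathbf T(f)=\lambda_1\circ\mathbf T(g_1)\circ\rho_1>\lambda_i\circ\mathbf T(g_i)\circ\rho_i$ for all $i>1$ (the zero element has the empty weak and strong representation); - Gröbner representation (left): $f=\sum l_i\star g_i$, $l_i\in\mathsf R\setminus\{0\}$, $\mathbf T(l_i)\circ\mathbf T(g_i)\le\mathbf T(f)$; (right): $f=\sum g_i\star r_i$, $r_i\in\mathsf R\setminus\{0\}$, $\mathbf T(g_i)\circ\mathbf T(r_i)\le\mathbf T(f)$; - $\mathbf M(F)$: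 the set of all monomials $a\lambda\ast\mathbf M(g)\ast b\rho$ (allowed $a,\lambda,b,\rho$; $g\in F$); $\mathbf M\{\mathbb I(\mathbf M\{F\})\}$: the set of all monomials $ct$ ($c\in R\setminus\{0\},t\in\mathcal T^{(m)}$) which are finite sums of elements of $\mathbf M(F)$ having term $t$; - $F$ is a strong Gröbner basis of $\mathbb I(F)$ if $\mathbf M(f)\in\mathbf M(F)$ for all $f\in\mathbb I(F)\setminus\{0\}$; a (weak) Gröbner basis if $\mathbf M(f)\in\mathbf M\{\mathbb I(\mathbf M\{F\})\}$ for all such $f$; - $h\in\mathsf R^m$ is a weak normal form of $f$ w.r.t. $F$ if $f-h\in\mathbb I(F)$ has a weak Gröbner representation in terms of $F$ and $h\ne0\Rightarrow\mathbf M(h)\notin\mathbf M\{\mathbb I(\mathbf M\{F\})\}$; a strong normal form if $f-h\in\mathbb I(F)$ has a strong Gröbner representation in terms of $F$ and $h\ne0\Rightarrow\mathbf M(h)\notin\mathbf M(F)$.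
   Formalization: In the right setting only, the final skew-field clause ((4)⇒(2), (5)⇒(3)) is proved under the added assumption that every α_i: R→R is surjective; without it the clause fails, e.g. R=Q(x), α(x)=x², δ=0, F={Y, xY}. *)

(* Defs.v *)
From HB Require Import structures.
From mathcomp Require Import all_boot all_order all_algebra finmap.
From mathcomp Require Import mpoly.
From Stdlib Require Import ClassicalEpsilon.

Set Implicit Arguments.
Unset Strict Implicit.
Unset Printing Implicit Defensive.

Import GRing.Theory.

Local Open Scope ring_scope.

Definition ring_domain (R : nzRingType) : Prop :=
  forall x y : R, x * y = 0 -> x = 0 \/ y = 0.

Definition skew_field (R : nzRingType) : Prop :=
  forall x : R, x <> 0 -> exists y : R, x * y = 1 /\ y * x = 1.

Record subring (S : nzRingType) (A : S -> Prop) : Prop := Subring {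
  subring1 : A 1;
  subringB : forall x y, A x -> A y -> A (x - y);
  subringM : forall x y, A x -> A y -> A (x * y) }.

(* For subrings A and B of an ambient ring S: B is the Ore extension           *)
(* A[Y; al, de].  Only the values of al and de on A are meaningful.            *)
Record ore_extension (S : nzRingType) (A B : S -> Prop) (Y : S)
    (al de : S -> S) : Prop := OreExtension {
  ore_base : subring A;
  ore_top : subring B;
  ore_sub : forall x, A x -> B x;
  ore_var : B Y;
  ore_al_stable : forall x, A x -> A (al x);
  ore_al1 : al 1 = 1;
  ore_alD : forall x y, A x -> A y -> al (x + y) = al x + al y;
  ore_alM : forall x y, A x -> A y -> al (x * y) = al x * al y;
  ore_al_inj : forall x y, A x -> A y -> al x = al y -> x = y;
  ore_de_stable : forall x, A x -> A (de x);
  ore_deD : forall x y, A x -> A y -> de (x + y) = de x + de y;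
  ore_deM : forall x y, A x -> A y -> de (x * y) = al x * de y + de x * y;
  ore_comm : forall x, A x -> Y * x = al x * Y + de x;
  ore_span : forall x, B x -> exists d (c : 'I_d -> S),
    (forall k, A (c k)) /\ x = \sum_(k < d) c k * Y ^+ k;
  ore_free : forall d (c : 'I_d -> S), (forall k, A (c k)) ->
    \sum_(k < d) c k * Y ^+ k = 0 -> forall k, c k = 0 }.

(* R[Y_0; alpha_0, delta_0]...[Y_(n-1); alpha_(n-1), delta_(n-1)], with R      *)
(* embedded by r |-> r%:A = r *: 1.  mo_sub k is the subring generated by R    *)
(* and Y_0, ..., Y_(k-1); mo_al i and mo_de i are the maps of the i-th Ore     *)
(* extension, defined on mo_sub i; mo_alpha i and mo_delta i are their         *)
(* restrictions to R.                                                          *)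
Record multiOre (R : nzRingType) (n : nat) := MultiOre {
  mo_ring :> lalgType R;
  mo_Y : 'I_n -> mo_ring;
  mo_alpha : 'I_n -> R -> R;
  mo_delta : 'I_n -> R -> R;
  mo_sub : nat -> mo_ring -> Prop;
  mo_al : 'I_n -> mo_ring -> mo_ring;
  mo_de : 'I_n -> mo_ring -> mo_ring;
  mo_embed : forall r r' : R, r%:A = r'%:A :> mo_ring -> r = r';
  mo_sub0 : forall x, mo_sub 0%N x <-> exists r : R, x = r%:A;
  mo_subn : forall x, mo_sub n x;
  mo_step : forall i : 'I_n,
    ore_extension (mo_sub i) (mo_sub i.+1) (mo_Y i) (mo_al i) (mo_de i);
  mo_alR : forall i (r : R), mo_al i r%:A = (mo_alpha i r)%:A;
  mo_deR : forall i (r : R), mo_de i r%:A = (mo_delta i r)%:A;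
  mo_alY : forall i j : 'I_n, (i < j)%N -> mo_al j (mo_Y i) = mo_Y i;
  mo_deY : forall i j : 'I_n, (i < j)%N -> mo_de j (mo_Y i) = 0;
  mo_alde : forall (i j : 'I_n) (r : R), i <> j ->
    mo_alpha j (mo_delta i r) = mo_delta i (mo_alpha j r);
  mo_alal : forall (i j : 'I_n) (r : R),
    mo_alpha i (mo_alpha j r) = mo_alpha j (mo_alpha i r);
  mo_dede : forall (i j : 'I_n) (r : R),
    mo_delta i (mo_delta j r) = mo_delta j (mo_delta i r) }.

(* Over a skew field, weak bases are strong in the right setting only under    *)
(* such a condition.  For R = Q(x), alpha(x) = x^2, delta = 0, n = m = 1, the  *)
(* set F = {Y, xY} generates the right ideal of all f without constant term,   *)
(* as Q(x) = Q(x^2) + x Q(x^2), and all these f have weak representations; but *)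
(* (1 + x)Y has no strong one, being of neither of the forms                   *)
(* Y * b = b(x^2) Y and xY * b = x b(x^2) Y.                                   *)
Definition alphas_onto (R : nzRingType) (n : nat) (O : multiOre R n) : Prop :=
  forall i (r : R), exists r', mo_alpha O i r' = r.

Record well_ordering (K : eqType) (lt : rel K) : Prop := WellOrdering {
  wo_irr : forall x, ~~ lt x x;
  wo_trans : forall x y z, lt x y -> lt y z -> lt x z;
  wo_total : forall x y, x <> y -> lt x y \/ lt y x;
  wo_wf : well_founded (fun x y => lt x y) }.

(* None stands below every element: it is the maximal term of 0.               *)
Definition olt (K : eqType) (lt : rel K) : rel (option K) :=
  fun x y => match x, y with
             | None, Some _ => true
             | Some a, Some b => lt a b
             | _, None => false
             end.

Definition ole (K : eqType) (lt : rel K) : rel (option K) :=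
  fun x y => (x == y) || olt lt x y.

(* The coordinates of v on the family b.  They are unspecified if v has none;  *)
(* below b is always a basis, so that they exist and are unique.               *)
Definition coord_on (R : nzRingType) (V : lmodType R) (K : choiceType)
    (b : K -> V) (v : V) : {fsfun K -> R with 0} :=
  epsilon (inhabits [fsfun])
    (fun c : {fsfun K -> R with 0} => v = \sum_(k <- finsupp c) c k *: b k).

Definition max_term (R : nzRingType) (V : lmodType R) (K : choiceType)
    (b : K -> V) (lt : rel K) (v : V) : option K :=
  \big[(fun x y => if olt lt x y then y else x) / None]_(k <- finsupp (coord_on b v))
    Some k.

Variant setting := Left | Right | Bilateral | Restricted.

(* the pair (i, a) encodes the term Y^a e_i of the free module *)
Notation mterm n m := ('I_m * 'X_{1..n})%type (only parsing).

Notation vec O m := {ffun 'I_m -> mo_ring O} (only parsing).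

Section Terms.

Variables (R : nzRingType) (n : nat) (O : multiOre R n) (m : nat).

(* Y_0^(a_0) * ... * Y_(n-1)^(a_(n-1)), the factors in this order *)
Definition term (a : 'X_{1..n}) : O := \prod_(i < n) mo_Y O i ^+ a i.

Definition vterm (t : mterm n m) : vec O m :=
  [ffun j => if j == t.1 then term t.2 else 0].

(* x * f * y for x, y in the Ore extension *)
Definition bimul (x : O) (f : vec O m) (y : O) : vec O m := [ffun i => x * f i * y].

(* lam o t o rho *)
Definition tmul (lam : 'X_{1..n}) (t : mterm n m) (rho : 'X_{1..n}) : mterm n m :=
  (t.1, (lam + t.2 + rho)%MM).

Definition alpha_term (a : 'X_{1..n}) : R -> R :=
  \big[(fun f g : R -> R => f \o g) / id]_(i < n) iter (a i) (mo_alpha O i).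

(* The multiplication of the associated graded ring, on monomials:             *)
(* (a tau) * (b om) = a alpha_tau(b) (tau o om).                               *)
Definition gmul (x y : R * 'X_{1..n}) : R * 'X_{1..n} :=
  (x.1 * alpha_term x.2 y.1, (x.2 + y.2)%MM).

(* x * (c t) * y for monomials x, y and a monomial c t of the free module *)
Definition gbimul (x : R * 'X_{1..n}) (u : R * (mterm n m)) (y : R * 'X_{1..n}) :
    R * (mterm n m) :=
  let z := gmul (gmul x (u.1, u.2.2)) y in (z.1, (u.2.1, z.2)).

Record term_ordering (ltT : rel 'X_{1..n}) : Prop := TermOrdering {
  to_wo : well_ordering ltT;
  to_mul : forall w a b, ltT a b -> ltT (w + a)%MM (w + b)%MM }.

Record compatible_ordering (ltT : rel 'X_{1..n}) (lt : rel (mterm n m)) : Prop :=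
    CompatibleOrdering {
  co_wo : well_ordering lt;
  co_mull : forall a b t, ltT a b -> lt (tmul a t 0%MM) (tmul b t 0%MM);
  co_mulr : forall w t1 t2, lt t1 t2 -> lt (tmul w t1 0%MM) (tmul w t2 0%MM) }.

Variables (ltT : rel 'X_{1..n}) (lt : rel (mterm n m)) (s : setting) (F : (vec O m) -> Prop).

Definition maxT (l : O) : option 'X_{1..n} := max_term term ltT l.

Definition maxTV (f : vec O m) : option (mterm n m) := max_term vterm lt f.

Definition maxM (f : vec O m) : option (R * (mterm n m)) :=
  omap (fun t => (coord_on vterm f t, t)) (maxTV f).

(* the data of a product  a lam * g * b rho *)
Record product := Product {
  p_a : R; p_lam : 'X_{1..n}; p_g : vec O m; p_b : R; p_rho : 'X_{1..n} }.

Definition allowed (p : product) : Prop :=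
  [/\ F (p_g p), p_a p <> 0, p_b p <> 0 &
    match s with
    | Left => p_b p = 1 /\ p_rho p = 0%MM
    | Right => p_a p = 1 /\ p_lam p = 0%MM
    | Bilateral => True
    | Restricted => p_lam p = 0%MM /\ p_b p = 1
    end].

Definition p_val (p : product) : vec O m :=
  bimul (p_a p *: term (p_lam p)) (p_g p) (p_b p *: term (p_rho p)).

(* lam o T(g) o rho *)
Definition p_term (p : product) : option (mterm n m) :=
  omap (fun t => tmul (p_lam p) t (p_rho p)) (maxTV (p_g p)).

(* T(lam * g * rho) *)
Definition p_maxT (p : product) : option (mterm n m) :=
  maxTV (bimul (term (p_lam p)) (p_g p) (term (p_rho p))).

Definition representation (f : vec O m) (mu : nat) (p : 'I_mu -> product) : Prop :=
  (forall i, allowed (p i)) /\ f = \sum_(i < mu) p_val (p i).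

(* I(F) *)
Definition gen (f : vec O m) : Prop :=
  exists mu (p : 'I_mu -> product), representation f p.

Definition has_weak_repr (f : vec O m) : Prop :=
  exists mu (p : 'I_mu -> product), representation f p /\
    forall i, ole lt (p_term (p i)) (maxTV f).

(* Indices start at 0.  As maxTV 0 = None, a strong representation of 0 is     *)
(* necessarily the empty one, and so is a weak one.                            *)
Definition strong_repr (f : vec O m) (mu : nat) (p : 'I_mu -> product) : Prop :=
  [/\ representation f p,
      forall i : 'I_mu, i = 0%N :> nat -> maxTV f = p_term (p i) &
      forall i : 'I_mu, (0 < i)%N -> olt lt (p_term (p i)) (maxTV f)].

Definition has_strong_repr (f : vec O m) : Prop :=
  exists mu (p : 'I_mu -> product), strong_repr f p.

Definition has_decreasing_strong_repr (f : vec O m) : Prop :=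
  exists mu (p : 'I_mu -> product),
    [/\ strong_repr f p,
        forall i : 'I_mu, i = 0%N :> nat -> maxTV f = p_maxT (p i) &
        forall i j : 'I_mu, (i < j)%N -> olt lt (p_maxT (p j)) (p_maxT (p i))].

(* T(l) o T(g), undefined when l or g is 0 *)
Definition tact (l : O) (g : vec O m) : option (mterm n m) :=
  obind (fun w => omap (fun t => tmul w t 0%MM) (maxTV g)) (maxT l).

Definition has_left_groebner_repr (f : vec O m) : Prop :=
  exists mu (l : 'I_mu -> O) (g : 'I_mu -> (vec O m)),
    [/\ forall i, F (g i) /\ l i <> 0,
        f = \sum_(i < mu) bimul (l i) (g i) 1 &
        forall i, ole lt (tact (l i) (g i)) (maxTV f)].

Definition has_right_groebner_repr (f : vec O m) : Prop :=
  exists mu (g : 'I_mu -> (vec O m)) (r : 'I_mu -> O),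
    [/\ forall i, F (g i) /\ r i <> 0,
        f = \sum_(i < mu) bimul 1 (g i) (r i) &
        forall i, ole lt (tact (r i) (g i)) (maxTV f)].

(* M(F) *)
Definition inMF (u : R * (mterm n m)) : Prop :=
  exists p, allowed p /\ exists2 v, maxM (p_g p) = Some v &
    u = gbimul (p_a p, p_lam p) v (p_b p, p_rho p).

(* M{I(M{F})} *)
Definition inMIMF (u : R * (mterm n m)) : Prop :=
  u.1 <> 0 /\ exists mu (c : 'I_mu -> R),
    (forall i, inMF (c i, u.2)) /\ u.1 = \sum_(i < mu) c i.

Definition maxM_in (P : R * (mterm n m) -> Prop) (f : vec O m) : Prop :=
  exists2 u, maxM f = Some u & P u.

Definition strong_groebner_basis : Prop :=
  forall f, gen f -> f <> 0 -> maxM_in inMF f.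

Definition weak_groebner_basis : Prop :=
  forall f, gen f -> f <> 0 -> maxM_in inMIMF f.

Definition weak_normal_form (f h : vec O m) : Prop :=
  [/\ gen (f - h), has_weak_repr (f - h) & h <> 0 -> ~ maxM_in inMIMF h].

Definition strong_normal_form (f h : vec O m) : Prop :=
  [/\ gen (f - h), has_strong_repr (f - h) & h <> 0 -> ~ maxM_in inMF h].

End Terms.

(* Main.v *)
Require Import Defs.
From mathcomp Require Import all_boot all_order all_algebra finmap mpoly.
From Stdlib Require Import Classical ClassicalEpsilon.

(** The terms form a left [R]-basis of the iterated Ore extension, and
    [Y^l r = alpha_l(r) Y^l + lower terms].  Since [R] is a domain and the [alpha_i]
    are injective, the maximal monomial of a product [a l * g * b w] is therefore the
    product of the maximal monomials in the associated graded ring; in particular it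
    never vanishes.  So, if the maximal monomial of [f] lies in [M(F)] (resp. is a sum
    of elements of [M(F)] with the same term), subtracting the corresponding products
    strictly decreases the maximal term, and the construction of representations and
    of normal forms is a well-founded induction on that term.  Conversely, comparing
    the coefficients of the maximal term in a representation of [f] shows that its
    maximal monomial is of the required form.  Over a skew field, a single product
    whose term is [T(f)] can be rescaled to match the leading coefficient of [f]: on
    the left in three of the settings, and on the right, by means of the surjectivity
    of the [alpha_i], in the right one. *)

Set Implicit Arguments.
Unset Strict Implicit.
Unset Printing Implicit Defensive.

Import GRing.Theory.

Local Open Scope ring_scope.

(** * Coordinates with respect to a basis of a left module *)

Lemma mem_enum_finsupp (K : choiceType) (R : nzRingType) (c : {fsfun K -> R with 0}) k :
  (k \in enum_fset (finsupp c)) = (c k != 0).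
Proof. exact: mem_finsupp. Qed.

Section Basis.

Variables (R : nzRingType) (V : lmodType R) (K : choiceType) (b : K -> V).

Definition free_family : Prop := forall (s : seq K) (c : K -> R), uniq s ->
  \sum_(k <- s) c k *: b k = 0 -> forall k, k \in s -> c k = 0.

(** Spanning is put as an induction principle, so that arguments can proceed one monomial at a time
    without naming an expansion. *)
Definition spanning_family : Prop := forall Q : V -> Prop,
  Q 0 -> (forall c k v, Q v -> Q (c *: b k + v)) -> forall v, Q v.

Lemma big_support (s s' : seq K) (c : K -> R) : uniq s -> uniq s' ->
  {subset s <= s'} ->
  \sum_(k <- s) c k *: b k = \sum_(k <- s') (if k \in s then c k else 0) *: b k.
Proof.
move=> us us' sub.
transitivity (\sum_(k <- s' | k \in s) c k *: b k); last first.
  by rewrite big_mkcond; apply: eq_bigr => k _; case: ifP; rewrite ?scale0r.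
rewrite -[RHS]big_filter; apply: perm_big; apply: uniq_perm => //.
  by rewrite filter_uniq.
by move=> k; rewrite mem_filter; case: (boolP (k \in s)) => // /sub ->.
Qed.

(** Applying [phi k] to a vanishing combination isolates the coefficient of [b k]. *)
Lemma dual_free (phi : K -> V -> R) :
  (forall k c u v, phi k (c *: u + v) = c * phi k u + phi k v) ->
  (forall k k', phi k (b k') = (k == k')%:R) -> free_family.
Proof.
move=> phiL phib s c us s0 k ks.
have phi0 : phi k 0 = 0.
  have := phiL k 1 0 0; rewrite scaler0 addr0 mul1r => /esym/eqP.
  by rewrite -subr_eq0 addrK => /eqP.
have phiS t : phi k (\sum_(j <- t) c j *: b j) = \sum_(j <- t) c j * (k == j)%:R.
  by elim: t => [|j t IH]; rewrite ?big_nil // !big_cons phiL phib IH.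
have := phiS s; rewrite s0 phi0 (bigD1_seq k) //= eqxx mulr1 big1 ?addr0 //.
by move=> j; rewrite eq_sym => /negbTE ->; rewrite mulr0.
Qed.

Hypotheses (bfree : free_family) (bspan : spanning_family).

Lemma exists_coord (v : V) : exists c : {fsfun K -> R with 0},
  v = \sum_(k <- finsupp c) c k *: b k.
Proof.
suff [s [c [us ->]]] : exists s (c : K -> R), uniq s /\ v = \sum_(k <- s) c k *: b k.
  pose f : {fsfun K -> R with 0} := [fsfun k in [fset k in s]%fset => c k].
  exists f.
  have sub : {subset enum_fset (finsupp f) <= s}.
    by move=> k; rewrite mem_enum_finsupp fsfunE inE; case: ifP; rewrite ?eqxx.
  rewrite [RHS](big_support _ (fset_uniq _) us sub).
  apply: eq_big_seq => k ks; congr (_ *: _); case: ifP => [_|/negbT].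
    by rewrite fsfunE inE ks.
  by rewrite mem_enum_finsupp negbK fsfunE inE ks => /eqP.
elim/bspan: v => [|a k v [s [c [us ->]]]].
  by exists [::], (fun=> 0); rewrite big_nil.
case: (boolP (k \in s)) => ks.
  exists s, (fun j => (j == k)%:R * a + c j); split=> //.
  under [RHS]eq_bigr do rewrite scalerDl.
  rewrite big_split /= (bigD1_seq k) //= [X in _ = X + _](bigD1_seq k) //=.
  rewrite eqxx mul1r; congr (_ + _); rewrite big1 ?addr0 //.
  by move=> j /negbTE ->; rewrite mul0r scale0r.
exists (k :: s), (fun j => if j == k then a else c j); split.
  by rewrite /= ks.
rewrite big_cons eqxx; congr (_ + _); apply: eq_big_seq => j js.
by case: eqP => // e; rewrite -e js in ks.
Qed.

Lemma coord_onK (v : V) :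
  v = \sum_(k <- finsupp (coord_on b v)) coord_on b v k *: b k.
Proof. exact: (epsilon_spec (inhabits [fsfun]) _ (exists_coord v)). Qed.

(** The chosen expansion of [v] and the given one are extended by zero to a common list, where
    freeness applies to their difference. *)
Lemma coord_on_sum (s : seq K) (c : K -> R) (k : K) : uniq s ->
  coord_on b (\sum_(j <- s) c j *: b j) k = if k \in s then c k else 0.
Proof.
move=> us; set v := \sum_(j <- s) _.
pose t := undup (s ++ finsupp (coord_on b v)).
have ut : uniq t by rewrite undup_uniq.
have st : {subset s <= t} by move=> j js; rewrite mem_undup mem_cat js.
have ft : {subset enum_fset (finsupp (coord_on b v)) <= t}.
  by move=> j js; rewrite mem_undup mem_cat js orbT.
have ifcoord j : (if j \in enum_fset (finsupp (coord_on b v)) then coord_on b v j else 0) =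
    coord_on b v j.
  by rewrite mem_enum_finsupp; case: eqP.
have e0 : \sum_(j <- t) ((if j \in s then c j else 0) - coord_on b v j) *: b j = 0.
  under eq_bigr do rewrite scalerBl.
  rewrite sumrB -(big_support _ us ut st) -/v {1}[v]coord_onK.
  rewrite (big_support _ (fset_uniq _) ut ft).
  by under eq_bigr do rewrite ifcoord; rewrite subrr.
have := bfree ut e0 (k := k); rewrite mem_undup mem_cat.
case: (boolP (k \in s)) => ks /=.
  by move=> /(_ isT) /eqP; rewrite subr_eq0 => /eqP ->.
rewrite mem_enum_finsupp; case: eqP => // _ /(_ isT) /eqP.
by rewrite sub0r oppr_eq0 => /eqP.
Qed.

Lemma coord_onP (a : R) (u v : V) (k : K) :
  coord_on b (a *: u + v) k = a * coord_on b u k + coord_on b v k.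
Proof.
pose t := undup (finsupp (coord_on b u) ++ finsupp (coord_on b v)).
have ut : uniq t by rewrite undup_uniq.
have ex w : {subset enum_fset (finsupp (coord_on b w)) <= t} ->
    w = \sum_(j <- t) coord_on b w j *: b j.
  move=> sub; rewrite {1}[w]coord_onK (big_support _ (fset_uniq _) ut sub).
  by apply: eq_bigr => j _; rewrite mem_enum_finsupp; case: eqP => // ->.
have eu : u = \sum_(j <- t) coord_on b u j *: b j.
  by apply: ex => j js; rewrite mem_undup mem_cat js.
have ev : v = \sum_(j <- t) coord_on b v j *: b j.
  by apply: ex => j js; rewrite mem_undup mem_cat js orbT.
have -> : a *: u + v = \sum_(j <- t) (a * coord_on b u j + coord_on b v j) *: b j.
  rewrite [in LHS]eu [in LHS]ev scaler_sumr -big_split /=.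
  by apply: eq_bigr => j _; rewrite scalerDl scalerA.
rewrite coord_on_sum //; case: ifP => //.
rewrite mem_undup mem_cat => /negbT; rewrite negb_or => /andP[].
by rewrite !mem_enum_finsupp !negbK => /eqP -> /eqP ->; rewrite mulr0 addr0.
Qed.

Lemma coord_on0 k : coord_on b 0 k = 0.
Proof.
have := coord_onP 1 0 0 k; rewrite scaler0 addr0 mul1r => /esym/eqP.
by rewrite -subr_eq0 addrK => /eqP.
Qed.

Lemma coord_onD u v k : coord_on b (u + v) k = coord_on b u k + coord_on b v k.
Proof. by rewrite -{1}[u]scale1r coord_onP mul1r. Qed.

Lemma coord_onZ a u k : coord_on b (a *: u) k = a * coord_on b u k.
Proof. by rewrite -[a *: u]addr0 coord_onP coord_on0 addr0. Qed.

Lemma coord_onB u v k : coord_on b (u - v) k = coord_on b u k - coord_on b v k.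
Proof. by rewrite coord_onD -scaleN1r coord_onZ mulN1r. Qed.

Lemma coord_on_basis k k' : coord_on b (b k') k = (k == k')%:R.
Proof.
have := @coord_on_sum [:: k'] (fun=> 1) k isT.
by rewrite big_seq1 scale1r inE => ->; case: eqP.
Qed.

Lemma coord_on_eq0 v : (forall k, coord_on b v k = 0) -> v = 0.
Proof.
by move=> v0; rewrite [v]coord_onK big1_seq // => k _; rewrite v0 scale0r.
Qed.

(** Induction on the monomials of [v] that remembers a property [P] of the terms that occur; later
    [P] is an upper bound on them. *)
Lemma coord_on_ind (P : K -> Prop) (Q : V -> Prop) : Q 0 ->
  (forall u v, Q u -> Q v -> Q (u + v)) ->
  (forall c k, c <> 0 -> P k -> Q (c *: b k)) ->
  forall v, (forall k, coord_on b v k <> 0 -> P k) -> Q v.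
Proof.
move=> Q0 QD Qb v vP; rewrite [v]coord_onK big_seq; apply: big_ind => // k.
by rewrite mem_enum_finsupp => /eqP cn0; apply: Qb => //; apply: vP.
Qed.

(** * Leading terms for a well-ordering of the basis *)

Variable lt : rel K.
Hypothesis wo : well_ordering lt.

Lemma ltxx k : lt k k = false.
Proof. exact/negbTE/(wo_irr wo). Qed.

Lemma lt_asym k k' : lt k k' -> lt k' k = false.
Proof.
by move=> kk'; apply/negP => /(wo_trans wo kk'); rewrite ltxx.
Qed.

(** Encodes T(v) < t, the zero vector included, coordinate by coordinate, so that closure under sums
    and multiples is immediate. *)
Definition below (t : K) (v : V) : Prop := forall k, coord_on b v k <> 0 -> lt k t.

(** Encodes M(v) = c t without computing a maximum: what matters is an error term below [t]. *)
Definition lead (v : V) (c : R) (t : K) : Prop := c <> 0 /\ below t (v - c *: b t).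

Lemma below0 t : below t 0.
Proof. by move=> k; rewrite coord_on0. Qed.

Lemma belowD t u v : below t u -> below t v -> below t (u + v).
Proof.
move=> tu tv k; rewrite coord_onD; case: (classic (coord_on b u k = 0)) => [->|/tu //].
by rewrite add0r => /tv.
Qed.

Lemma belowZ t a u : below t u -> below t (a *: u).
Proof.
by move=> tu k; rewrite coord_onZ => h; apply: tu => e; apply: h; rewrite e mulr0.
Qed.

Lemma belowB t u v : below t u -> below t v -> below t (u - v).
Proof. by move=> tu tv; rewrite -scaleN1r; apply/belowD/belowZ. Qed.

Lemma below_basis t k : lt k t -> below t (b k).
Proof.
by move=> kt j; rewrite coord_on_basis; case: eqP => [->|//].
Qed.

Lemma below_trans t t' u : lt t t' -> below t u -> below t' u.
Proof. by move=> tt' tu k /tu kt; apply: wo_trans tt'. Qed.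

Lemma below_coord t u : below t u -> coord_on b u t = 0.
Proof. by move=> tu; apply: NNPP => /tu; rewrite ltxx. Qed.

Lemma lead_coord v c t : lead v c t -> coord_on b v t = c.
Proof.
case=> _ /below_coord; rewrite coord_onB coord_onZ coord_on_basis eqxx mulr1.
by move/eqP; rewrite subr_eq0 => /eqP.
Qed.

Lemma lead_lt v c t k : lead v c t -> coord_on b v k <> 0 -> k = t \/ lt k t.
Proof.
move=> [_ vb] vk; case: (eqVneq k t) => [|nkt]; [by left | right].
by apply: vb; rewrite coord_onB coord_onZ coord_on_basis (negbTE nkt) mulr0 subr0.
Qed.

Lemma big_max_term (s : seq K) (k : K) : k \in s ->
  exists2 t, \big[(fun x y => if olt lt x y then y else x) / None]_(k <- s) Some k = Some t &
    t \in s /\ forall j, j \in s -> j = t \/ lt j t.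
Proof.
elim: s k => // a s IH k _; rewrite big_cons.
case: s IH => [_|a' s IH].
  by rewrite big_nil /=; exists a => //; split=> [|j]; rewrite inE ?eqxx // => /eqP; left.
have [t -> [ts tmax]] := IH a' (mem_head _ _); rewrite /olt.
case: ifP => at_.
  exists t => //; split; first by rewrite inE ts orbT.
  by move=> j; rewrite inE => /orP[/eqP ->|/tmax //]; right.
exists a => //; split; first exact: mem_head.
move=> j; rewrite inE => /orP[/eqP ->|/tmax]; first by left.
case: (classic (t = a)) => [-> //|/(wo_total wo) [ta|]]; last by rewrite at_.
by case=> [->|jt]; right=> //; apply: wo_trans ta.
Qed.

Lemma max_term0 : max_term b lt 0 = None.
Proof.
rewrite /max_term; case e: (enum_fset _) => [|k s]; first by rewrite big_nil.
have : k \in enum_fset (finsupp (coord_on b 0)) by rewrite e mem_head.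
by rewrite mem_enum_finsupp coord_on0 eqxx.
Qed.

Lemma lead_exists v : v <> 0 ->
  exists2 t, max_term b lt v = Some t & lead v (coord_on b v t) t.
Proof.
move=> v0.
have [k kv] : exists k, coord_on b v k <> 0.
  apply: NNPP => h; apply: v0; apply: coord_on_eq0 => k; apply: NNPP => hk.
  by apply: h; exists k.
have kf : k \in enum_fset (finsupp (coord_on b v)) by rewrite mem_enum_finsupp; apply/eqP.
have [t tE [tf tmax]] := big_max_term kf; exists t => //.
split; first by apply/eqP; rewrite -mem_enum_finsupp.
move=> j; rewrite coord_onB coord_onZ coord_on_basis.
case: eqP => [->|/eqP njt]; first by rewrite mulr1 subrr.
rewrite mulr0 subr0 => /eqP; rewrite -mem_enum_finsupp => /tmax [e|//].
by rewrite e eqxx in njt.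
Qed.

Lemma lead_neq0 v c t : lead v c t -> v <> 0.
Proof. by move=> vl v0; case: (vl) => c0 _; rewrite -(lead_coord vl) v0 coord_on0 in c0. Qed.

Lemma lead_max v c t : lead v c t -> max_term b lt v = Some t.
Proof.
move=> vl; have [t' -> vl'] := lead_exists (lead_neq0 vl); congr Some.
have [|//|t't] := lead_lt vl (k := t').
  by case: vl'.
have [||tt'] := lead_lt vl' (k := t); first by rewrite (lead_coord vl); case: vl.
  by move->.
by rewrite (lt_asym tt') in t't.
Qed.

Lemma max_term_lead v t : max_term b lt v = Some t -> lead v (coord_on b v t) t.
Proof.
move=> vt; have [v0|/lead_exists [t' e l]] := classic (v = 0).
  by move: vt; rewrite v0 max_term0.
by move: vt; rewrite e => -[<-].
Qed.

Lemma max_term_eq0 v : max_term b lt v = None -> v = 0.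
Proof.
by move=> e; apply: NNPP => /lead_exists [t]; rewrite e.
Qed.

Lemma max_term_below v t : olt lt (max_term b lt v) (Some t) <-> below t v.
Proof.
split=> [|vb].
  case e: (max_term b lt v) => [t'|] /=; last by move=> _; rewrite (max_term_eq0 e); exact: below0.
  move=> t't k /(lead_lt (max_term_lead e)) [->//|kt']; exact: wo_trans t't.
case e: (max_term b lt v) => [t'|] //=.
by apply: vb; case: (max_term_lead e).
Qed.

Lemma leadD v c t u : lead v c t -> below t u -> lead (v + u) c t.
Proof. by move=> [c0 vb] ub; split=> //; rewrite addrAC; apply: belowD. Qed.

Lemma lead_subr v w c t : lead v c t -> lead w c t -> below t (v - w).
Proof.
move=> [_ vb] [_ wb]; have := belowB vb wb; congr below.
by rewrite opprB addrA subrK.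
Qed.

(** [None] is accessible because nothing lies below it; every [Some k] then follows by induction
    along [lt]. *)
Lemma olt_wf : well_founded (fun x y : option K => olt lt x y).
Proof.
have accN : Acc (fun x y : option K => olt lt x y) None by split=> -[].
case=> [k|]; last exact: accN.
elim/(well_founded_ind (wo_wf wo)): k => k IH.
by split=> -[k' /IH|_]; last exact: accN.
Qed.

Lemma max_term_ind (Q : V -> Prop) :
  (forall v, (forall u, olt lt (max_term b lt u) (max_term b lt v) -> Q u) -> Q v) ->
  forall v, Q v.
Proof.
move=> IH v; move: {2}(max_term b lt v) (erefl (max_term b lt v)) => o.
elim/(well_founded_ind olt_wf): o v => o IHo v vo; apply: IH => u; rewrite vo => uo.
exact: IHo uo _ _.
Qed.

End Basis.

(** * The terms as a left basis of the iterated Ore extension *)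

Section OreRing.

Variables (R : nzRingType) (n : nat) (O : multiOre R n).
Implicit Types (a l : 'X_{1..n}) (r : R) (x : O).

Lemma mo_sub_mono (j k : nat) x : (j <= k <= n)%N -> mo_sub j x -> mo_sub k x.
Proof.
case/andP=> /subnK <-; elim: (k - j)%N => [//|d IH] hd xj.
by rewrite addSn in hd *; apply: (ore_sub (mo_step O (Ordinal hd))); apply: IH => //; apply: ltnW.
Qed.

Lemma mo_subR k r : (k <= n)%N -> mo_sub k (r%:A : O).
Proof. by move=> kn; apply: (@mo_sub_mono 0); rewrite ?kn //; apply/mo_sub0; exists r. Qed.

Lemma mulYR i r : mo_Y O i * r%:A = mo_alpha O i r *: mo_Y O i + (mo_delta O i r)%:A.
Proof.
rewrite (ore_comm (mo_step O i)) ?mo_alR ?mo_deR ?mulr_algl //.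
exact: mo_subR (ltnW (ltn_ord i)).
Qed.

(** Scalars come out of the left factor only; a scalar inside the right factor is turned into right
    multiplication of [x] by a coefficient. *)
Lemma scale_mulrA r (x y : O) : x * (r *: y) = (x * r%:A) * y.
Proof. by rewrite -mulrA mulr_algl. Qed.

(** For i < j, the j-th endomorphism fixes Y_i and the j-th derivation kills it, so the commutation
    rule for Y_j becomes Y_j Y_i = Y_i Y_j. *)
Lemma commYY i j : GRing.comm (mo_Y O i) (mo_Y O j).
Proof.
wlog ij : i j / (i < j)%N => [W|].
  by case: (ltngtP i j) => [/W //|/W/esym //|/val_inj ->].
rewrite /GRing.comm (ore_comm (mo_step O j)) ?(mo_alY O ij) ?(mo_deY O ij) ?addr0 //.
apply: (@mo_sub_mono i.+1); last exact: (ore_var (mo_step O i)).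
by rewrite ij ltnW.
Qed.

Lemma termD a l : term O (a + l)%MM = term O a * term O l.
Proof.
rewrite /term; elim: (index_enum _) => [|i s IH]; first by rewrite !big_nil mulr1.
rewrite !big_cons IH mnmDE exprD -!mulrA; congr (_ * _); rewrite !mulrA; congr (_ * _).
apply: commr_prod => j _; apply/commrX/commr_sym/commrX/commYY.
Qed.

Lemma term0 : term O 0%MM = 1.
Proof. by rewrite /term big1 // => i _; rewrite mnm0E. Qed.

Lemma termU i k : term O (U_(i) *+ k)%MM = mo_Y O i ^+ k.
Proof.
rewrite /term (eq_bigr (fun j => if j == i then mo_Y O i ^+ k else 1)) => [|j _].
  by rewrite -big_mkcond big_pred1_eq.
by rewrite mulmnE mnm1E eq_sym; case: eqP => [->|]; rewrite ?mul1n ?mul0n.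
Qed.

(** The index is a natural number and not an ordinal, so that [k] can vary in an induction on the
    number of variables. *)
Definition pterm (k : nat) a : O :=
  \prod_(0 <= i < k) oapp (fun j => mo_Y O j ^+ a j) 1 (insub i).

Lemma pterm_full a : pterm n a = term O a.
Proof. by rewrite /pterm big_mkord; apply: eq_bigr => i _; rewrite valK. Qed.

Lemma ptermS a (i : 'I_n) : pterm i.+1 a = pterm i a * mo_Y O i ^+ a i.
Proof. by rewrite /pterm big_nat_recr //= valK. Qed.

(** For [k > 0] closure comes from the top ring of the preceding step. For [k = 0] there is no such
    step, and the elements are the scalars from R. *)
Lemma mo_subD k (kn : (k <= n)%N) (x y : O) : mo_sub k x -> mo_sub k y -> mo_sub k (x + y).
Proof.
case: k kn => [_ /mo_sub0 [r ->] /mo_sub0 [r' ->]|k kn xk yk].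
  by apply/mo_sub0; exists (r + r'); rewrite scalerDl.
have S := ore_top (mo_step O (Ordinal kn)).
rewrite -[y]opprK; apply: (subringB S) => //; rewrite -sub0r; apply: (subringB S) => //.
by rewrite -(subrr 1); apply: (subringB S); exact: subring1 S.
Qed.

Lemma mo_subM k (kn : (k <= n)%N) (x y : O) : mo_sub k x -> mo_sub k y -> mo_sub k (x * y).
Proof.
case: k kn => [_ /mo_sub0 [r ->] /mo_sub0 [r' ->]|k kn].
  by apply/mo_sub0; exists (r * r'); rewrite mulr_algl scalerA.
exact: (subringM (ore_top (mo_step O (Ordinal kn)))).
Qed.

Lemma pterm_sub k a : (k <= n)%N -> mo_sub k (pterm k a).
Proof.
elim: k => [_|k IH kn].
  by rewrite /pterm big_geq // -[1]scale1r; apply: mo_subR.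
rewrite (ptermS a (Ordinal kn)); apply: mo_subM => //.
  by apply: (@mo_sub_mono k); [rewrite leqnSn | apply/IH/ltnW].
elim: (a _) => [|e IHe]; first by rewrite expr0 -[1]scale1r; apply: mo_subR.
by rewrite exprS; apply: mo_subM => //; apply: (ore_var (mo_step O (Ordinal kn))).
Qed.

(* Agreement of the exponents beyond k replaces the condition that they vanish: *)
(* it is inherited by the fibres of the k-th exponent.                          *)
Lemma pterm_free k (s : seq 'X_{1..n}) (c : 'X_{1..n} -> R) : (k <= n)%N -> uniq s ->
  (forall a l, a \in s -> l \in s -> forall i : 'I_n, (k <= i)%N -> a i = l i) ->
  \sum_(a <- s) c a *: pterm k a = 0 -> forall a, a \in s -> c a = 0.
Proof.
elim: k s => [|k IH] s kn us agree s0 a as_.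
  (* With no variable left, agreement of all exponents reduces [s] to the single term [a], and the
     embedding of R is injective. *)
  have allE l : l \in s -> l = a.
    by move=> ls; apply/mnmP => i; apply: agree.
  have sE : s = [:: a].
    case: s us allE as_ {agree s0} => [//|x [|y s]] us allE _.
      by rewrite (allE x) ?mem_head.
    have ex := allE x (mem_head _ _); have ey : y = a by apply: allE; rewrite !inE eqxx orbT.
    by move: us; rewrite ex ey /= inE eqxx.
  move: s0; rewrite sE big_seq1 /pterm big_geq // => ca.
  by apply: (@mo_embed _ _ O); rewrite ca scale0r.
(* The sum is grouped by the exponent of the last variable: [C j] is the coefficient of its [j]-th
   power, and [d] exceeds all exponents that occur. *)
pose i := Ordinal kn; pose d := (\max_(l <- s) l i).+1%N.
have ltd l : l \in s -> (l i < d)%N.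
  by move=> ls; rewrite ltnS; apply: (leq_bigmax_seq (F := fun l : 'X_{1..n} => l i)).
pose C (j : 'I_d) : O := \sum_(l <- s | l i == j) c l *: pterm k l.
have CA j : mo_sub i (C j).
  rewrite /C; apply: (big_ind (fun x : O => mo_sub k x)).
  - by rewrite -(scale0r 1); apply/mo_subR/ltnW.
  - by move=> x y; apply/mo_subD/ltnW.
  by move=> l _; rewrite -mulr_algl; apply: mo_subM; [| apply: mo_subR | apply: pterm_sub];
     apply: ltnW.
have C0 : \sum_(j < d) C j * mo_Y O i ^+ j = 0.
  rewrite -[RHS]s0 (eq_bigr (fun j : 'I_d => \sum_(l <- s | l i == j) c l *: pterm k.+1 l)).
    rewrite (exchange_big_dep xpredT) //= big_seq [RHS]big_seq; apply: eq_bigr => l ls.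
    by rewrite (big_pred1 (Ordinal (ltd l ls))) // => j; rewrite eq_sym.
  move=> j _; rewrite mulr_suml; apply: eq_bigr => l /eqP <-.
  by rewrite -scalerAl -(ptermS l i).
have := ore_free (mo_step O i) CA C0 (Ordinal (ltd a as_)).
rewrite /C -big_filter => Ca.
(* Freeness of the powers of the last variable has made [C (a i)] vanish; the induction hypothesis
   applies to the terms of [s] that share this exponent with [a]. *)
apply: (IH _ (ltnW kn) (filter_uniq _ us) _ Ca).
  move=> l l'; rewrite !mem_filter => /andP[/eqP li ls] /andP[/eqP l'i l's] j.
  rewrite leq_eqVlt => /orP[/eqP kj|]; last exact: agree.
  by have -> : j = i by [apply: val_inj]; rewrite li l'i.
by rewrite mem_filter eqxx.
Qed.

Lemma term_free : free_family (term O).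
Proof.
move=> s c us s0; apply: (pterm_free (leqnn n) us).
  by move=> a l _ _ i; rewrite leqNgt ltn_ord.
by under eq_bigr do rewrite pterm_full.
Qed.

Lemma term_span : spanning_family (term O).
Proof.
move=> Q Q0 QD x.
(* [S k] is the left span of the terms whose exponents vanish from index [k] on, defined
   impredicatively by its induction principle. *)
pose S k y := forall Q' : O -> Prop, Q' 0 ->
  (forall c a v, (forall i : 'I_n, (k <= i)%N -> a i = 0%N) -> Q' v ->
     Q' (c *: term O a + v)) -> Q' y.
suff sub_S k : (k <= n)%N -> forall y : O, mo_sub k y -> S k y.
  apply: (sub_S n (leqnn n) x (mo_subn x)) => // c a v _; exact: QD.
elim: k => [|k IH] kn {}x.
  move=> /mo_sub0 [r ->] Q' Q'0 Q'D; rewrite -[_%:A]addr0 -term0; apply: Q'D => // i _.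
  by rewrite mnm0E.
have SD y z : S k.+1 y -> S k.+1 z -> S k.+1 (y + z).
  move=> Sy Sz Q' Q'0 Q'D; apply: (Sy (fun y => Q' (y + z))).
    by rewrite add0r; apply: Sz.
  by move=> c a v ha Q'v; rewrite -addrA; apply: Q'D.
move=> /(ore_span (mo_step O (Ordinal kn))) [d [c [cA ->]]].
apply: (big_ind (S k.+1)) => [Q' //|//|j _].
(* The coefficient [c j] is a combination of terms in the previous variables; right multiplication
   by a power of the new variable sends these to terms. *)
apply: (IH (ltnW kn) (c j) (cA j) (fun y => S k.+1 (y * _))) => [|r a v ha Sv].
  by rewrite mul0r => Q'.
rewrite mulrDl -scalerAl; apply: SD => //; rewrite -termU -termD => Q' Q'0 Q'D.
rewrite -[_ *: _]addr0; apply: Q'D => // i ki.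
rewrite mnmDE mulmnE mnm1E ha ?(ltnW ki) // add0n; case: eqP => // e.
by rewrite -e /= ltnn in ki.
Qed.

(** * The endomorphisms attached to terms *)

Lemma alphaD i r r' : mo_alpha O i (r + r') = mo_alpha O i r + mo_alpha O i r'.
Proof.
have sR u : mo_sub i (u%:A : O) by apply/mo_subR/ltnW.
apply: (@mo_embed _ _ O); rewrite -mo_alR !scalerDl (ore_alD (mo_step O i)) //.
by rewrite !mo_alR.
Qed.

Lemma alpha1 i : mo_alpha O i 1 = 1.
Proof.
by apply: (@mo_embed _ _ O); rewrite -mo_alR !scale1r (ore_al1 (mo_step O i)).
Qed.

Lemma alpha_inj i : injective (mo_alpha O i).
Proof.
have sR u : mo_sub i (u%:A : O) by apply/mo_subR/ltnW.
move=> r r' e; apply: (@mo_embed _ _ O); apply: (ore_al_inj (mo_step O i)) => //.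
by rewrite !mo_alR e.
Qed.

Lemma alpha0 i : mo_alpha O i 0 = 0.
Proof. by apply: (addrI (mo_alpha O i 0)); rewrite -alphaD !addr0. Qed.

Lemma alpha_term_ind (P : (R -> R) -> Prop) a : P id ->
  (forall f g, P f -> P g -> P (f \o g)) -> (forall i, P (mo_alpha O i)) ->
  P (alpha_term O a).
Proof.
move=> P1 PM Pa; rewrite /alpha_term; apply: (big_ind P) => // i _.
elim: (a i) => [//|k]; exact: (PM _ (iter k (mo_alpha O i)) (Pa i)).
Qed.

Lemma alpha_term1 a : alpha_term O a 1 = 1.
Proof.
apply: (alpha_term_ind (P := fun f => f 1 = 1)) => // [f g f1 g1|i].
  by rewrite /= g1.
exact: alpha1.
Qed.

Lemma alpha_term0 a : alpha_term O a 0 = 0.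
Proof.
apply: (alpha_term_ind (P := fun f => f 0 = 0)) => // [f g f0 g0|i].
  by rewrite /= g0.
exact: alpha0.
Qed.

Lemma alpha_term_neq0 a r : r <> 0 -> alpha_term O a r <> 0.
Proof.
move: r; apply: (alpha_term_ind (P := fun f => forall r, r <> 0 -> f r <> 0)) => //.
  by move=> f g f0 g0 r r0; apply/f0/g0.
by move=> i r r0; rewrite -(alpha0 i) => /alpha_inj.
Qed.

Lemma alpha_term_onto a : alphas_onto O -> forall r, exists r', alpha_term O a r' = r.
Proof.
move=> onto; apply: (alpha_term_ind (P := fun f => forall r, exists r', f r' = r)) => //.
  by move=> r; exists r.
by move=> f g fo go r; have [r' <-] := fo r; have [r'' <-] := go r'; exists r''.
Qed.

(** * Commutation of terms with coefficients up to lower terms *)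

Variable ltT : rel 'X_{1..n}.
Hypothesis ordT : term_ordering ltT.

Let woT := to_wo ordT.

Lemma ltT_add2r a l w : ltT a l -> ltT (a + w)%MM (l + w)%MM.
Proof. by rewrite ![(_ + w)%MM]addmC; apply: to_mul. Qed.

(* otherwise a > 2a > 3a > ... would be an infinite descent *)
Lemma ltT_ge0 a : a <> 0%MM -> ltT 0%MM a.
Proof.
move=> a0; case: (wo_total woT a0) => // lta; exfalso.
suff : forall l : 'X_{1..n}, forall k, l <> (a *+ k)%MM by move/(_ 0%MM 0%N); rewrite mulm0n.
apply: (well_founded_ind (wo_wf woT)) => l IH k le.
apply: (IH (a *+ k.+1)%MM _ k.+1 (erefl _)).
by rewrite le mulmS -{2}[(a *+ k)%MM]add0m; apply: ltT_add2r.
Qed.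

Notation belowT := (below (term O) ltT).

Let D := belowD term_free term_span (lt := ltT).

Lemma below_mulr a l x : belowT a x -> belowT (a + l)%MM (x * term O l).
Proof.
move: x; apply: (coord_on_ind term_span (P := fun k => ltT k a)
  (Q := fun x => belowT (a + l)%MM (x * term O l))) => [|x y hx hy|c k _ ka].
- by rewrite mul0r; apply: below0 term_free term_span _ _.
- by rewrite mulrDl; apply: D.
rewrite -scalerAl -termD; apply: (belowZ term_free term_span).
by apply: (below_basis term_free term_span); apply: ltT_add2r.
Qed.

(** The twist [f] is left arbitrary, so that the rule can be proved for variables and propagated
    along products. *)
Definition term_comm a (f : R -> R) :=
  forall r, belowT a (term O a * r%:A - f r *: term O a).

(** Moving [r] through Y^l and then through Y^a leaves two errors: that of Y^a multiplied by Y^l,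
    and Y^a times that of Y^l. Both are below Y^(a+l). *)
Lemma term_commM a l f g : term_comm a f -> term_comm l g -> term_comm (a + l)%MM (f \o g).
Proof.
move=> af lg r; rewrite termD /=.
set y := term O l * r%:A - g r *: term O l.
have -> : term O a * term O l * r%:A - f (g r) *: (term O a * term O l) =
    (term O a * (g r)%:A - f (g r) *: term O a) * term O l + term O a * y.
  rewrite mulrBl mulrBr (scale_mulrA _ _ (term O l)) -scalerAl [in RHS]mulrA.
  by rewrite [RHS]addrC [RHS]addrA subrK.
apply: D; first exact/below_mulr/af.
(* The error [y] is treated by monomials: c Y^k with k < l is sent to f(c) Y^(a+k) plus lower
   terms. *)
move: (y) (lg r : belowT l y);
apply: (coord_on_ind term_span (P := fun k => ltT k l)
  (Q := fun y => belowT (a + l)%MM (term O a * y))) => [|u v hu hv|c k _ kl].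
- by rewrite mulr0; apply: below0 term_free term_span _ _.
- by rewrite mulrDr; apply: D.
rewrite scale_mulrA.
have lt1 : ltT (a + k)%MM (a + l)%MM by apply: to_mul.
rewrite -[term O a * _](subrK (f c *: term O a)) mulrDl; apply: D.
  by apply: (below_trans woT lt1); apply/below_mulr/af.
rewrite -scalerAl -termD; apply: (belowZ term_free term_span).
exact: (below_basis term_free term_span).
Qed.

Lemma term_commP a : term_comm a (alpha_term O a).
Proof.
have c0 : term_comm 0%MM id.
  by move=> r; rewrite term0 mul1r subrr; apply: below0 term_free term_span _ _.
have cU i : term_comm U_(i)%MM (mo_alpha O i).
  (* For one variable the error is delta_i(r), a multiple of the term 1, which is the smallest
     term. *)
  move=> r; have -> : term O U_(i)%MM = mo_Y O i by rewrite -[U_(i)%MM]mulm1n termU expr1.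
  rewrite mulYR addrC addKr -term0; apply: (belowZ term_free term_span).
  apply: (below_basis term_free term_span); apply: ltT_ge0 => /mnmP /(_ i).
  by rewrite mnm1E eqxx mnm0E.
(* The exponent is split into multiples of unit vectors, in the order of the factors of
   [alpha_term]. *)
rewrite {1}[a]multinomUE_id /alpha_term; elim: (index_enum _) => [|i s IH].
  by rewrite !big_nil.
rewrite !big_cons; apply: term_commM => //.
elim: (a i) => [|k]; first by rewrite mulm0n.
by rewrite mulmS; apply: (term_commM (cU i)).
Qed.

Lemma below_mul_coef a r x : belowT a x -> belowT a (x * r%:A).
Proof.
move: x; apply: (coord_on_ind term_span (P := fun k => ltT k a)
  (Q := fun x => belowT a (x * r%:A))) => [|x y hx hy|c k _ ka].
- by rewrite mul0r; apply: below0 term_free term_span _ _.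
- by rewrite mulrDl; apply: D.
rewrite -scalerAl; apply: (belowZ term_free term_span).
rewrite -[_ * _](subrK (alpha_term O k r *: term O k)); apply: D.
  by apply: (below_trans woT ka); apply: term_commP.
by apply: (belowZ term_free term_span); apply: (below_basis term_free term_span).
Qed.

(** First [c] is moved through Y^l, then [r] through Y^(l+a). This produces the graded product, and
    [y] and [z] are the two errors. *)
Lemma monomial_mul l c a r w :
  belowT (l + a + w)%MM (term O l * (c *: term O a) * (r *: term O w) -
    (alpha_term O l c * alpha_term O (l + a)%MM r) *: term O (l + a + w)%MM).
Proof.
set x := term O l * (c *: term O a); pose y := x - alpha_term O l c *: term O (l + a)%MM.
have ya : belowT (l + a)%MM y.
  have := below_mulr (l := a) (term_commP (a := l) (r := c)).
  by rewrite mulrBl -scalerAl -termD -mulrA mulr_algl.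
pose z := term O (l + a)%MM * r%:A - alpha_term O (l + a)%MM r *: term O (l + a)%MM.
have -> : x * (r *: term O w) -
    (alpha_term O l c * alpha_term O (l + a)%MM r) *: term O (l + a + w)%MM =
    (y * r%:A + alpha_term O l c *: z) * term O w.
  rewrite /y /z scale_mulrA mulrBl scalerBr scalerAl addrA subrK mulrBl; congr (_ - _).
  by rewrite termD -scalerA !scalerAl.
apply: below_mulr; apply: D; first exact: below_mul_coef.
by apply: (belowZ term_free term_span); apply: term_commP.
Qed.

End OreRing.

(** * Leading monomials in the free module *)

Section OreModule.

Variables (R : nzRingType) (n : nat) (O : multiOre R n) (m : nat).
Implicit Types (a l w : 'X_{1..n}) (t : mterm n m) (f g : vec O m).

Definition inj_comp (i : 'I_m) (x : O) : vec O m := [ffun j => if j == i then x else 0].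

Lemma inj_compP i c x y : inj_comp i (c *: x + y) = c *: inj_comp i x + inj_comp i y.
Proof.
by apply/ffunP => j; rewrite !ffunE; case: eqP => _; rewrite ?scaler0 ?addr0.
Qed.

Lemma inj_comp0 i : inj_comp i 0 = 0.
Proof. by apply/ffunP => j; rewrite !ffunE; case: eqP. Qed.

Lemma vterm_free : free_family (vterm O (m := m)).
Proof.
apply: (dual_free (phi := fun t f => coord_on (term O) (f t.1) t.2)) => [k c u v|k k'].
  by rewrite !ffunE; apply: (coord_onP (@term_free _ _ O) (@term_span _ _ O)).
case: k k' => [i a] [j l]; rewrite ffunE /= xpair_eqE; case: eqP => _ /=.
  exact: (coord_on_basis (@term_free _ _ O) (@term_span _ _ O)).
exact: (coord_on0 (@term_free _ _ O) (@term_span _ _ O)).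
Qed.

Lemma vterm_span : spanning_family (vterm O (m := m)).
Proof.
move=> Q Q0 QD f.
have Qi i x : forall v, Q v -> Q (inj_comp i x + v).
  move: x; apply: (@term_span _ _ O) => [v|c k x IH v Qv].
    by rewrite inj_comp0 add0r.
  by rewrite inj_compP -addrA; apply: (QD c (i, k)); apply: IH.
have -> : f = \sum_i inj_comp i (f i).
  apply/ffunP => j; rewrite sum_ffunE (bigD1 j) //= ffunE eqxx big1 ?addr0 // => i.
  by rewrite eq_sym ffunE => /negbTE ->.
by elim: (index_enum _) => [|i s IH]; rewrite ?big_nil // big_cons; apply: Qi.
Qed.

Lemma bimulDm x y f g : bimul x (f + g) y = bimul x f y + bimul x g y.
Proof. by apply/ffunP => i; rewrite !ffunE mulrDr mulrDl. Qed.

Lemma bimul0m x y : bimul x (0 : vec O m) y = 0.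
Proof. by apply/ffunP => i; rewrite !ffunE mulr0 mul0r. Qed.

Lemma bimulZl c x y f : bimul (c *: x) f y = c *: bimul x f y.
Proof. by apply/ffunP => i; rewrite !ffunE -!scalerAl. Qed.

Lemma bimulDl x x' y f : bimul (x + x') f y = bimul x f y + bimul x' f y.
Proof. by apply/ffunP => i; rewrite !ffunE !mulrDl. Qed.

Lemma bimulDr x y y' f : bimul x f (y + y') = bimul x f y + bimul x f y'.
Proof. by apply/ffunP => i; rewrite !ffunE mulrDr. Qed.

Lemma bimul0l y f : bimul 0 f y = 0.
Proof. by apply/ffunP => i; rewrite !ffunE !mul0r. Qed.

Lemma bimul0r x f : bimul x f 0 = 0.
Proof. by apply/ffunP => i; rewrite !ffunE mulr0. Qed.

Variables (ltT : rel 'X_{1..n}) (lt : rel (mterm n m)).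
Hypotheses (ordT : term_ordering ltT) (ordM : compatible_ordering ltT lt).

Let wo := co_wo ordM.

(** Compatibility is assumed for left multiplication; a right factor can be moved to the left
    because exponents add commutatively. *)
Lemma lt_tmul l t1 t2 w : lt t1 t2 -> lt (tmul l t1 w) (tmul l t2 w).
Proof.
move=> /(co_mulr ordM (l + w)%MM); rewrite /tmul /= !addm0.
by rewrite -!addmA ![(w + _)%MM]addmC.
Qed.

(** Here the two orderings meet: [co_mull] at the basis vector e_i carries k < a to k e_i < a
    e_i. *)
Lemma below_inj_comp i a x : below (term O) ltT a x ->
  below (vterm O (m := m)) lt (i, a) (inj_comp i x).
Proof.
move: x; apply: (coord_on_ind (@term_span _ _ O) (P := fun k => ltT k a)
  (Q := fun x => below (vterm O (m := m)) lt (i, a) (inj_comp i x))).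
- by rewrite inj_comp0; apply: below0 vterm_free vterm_span _ _.
- move=> x y hx hy; rewrite -[x]scale1r inj_compP scale1r.
  exact: (belowD vterm_free vterm_span).
move=> c k _ ka; rewrite -[_ *: _]addr0 inj_compP inj_comp0 addr0.
apply: (belowZ vterm_free vterm_span).
apply: (below_basis vterm_free vterm_span (k := (i, k))).
by have := co_mull ordM (i, 0%MM) ka; rewrite /tmul /= !addm0.
Qed.

Lemma vmonomial_mul l c t r w :
  below (vterm O (m := m)) lt (tmul l t w)
    (bimul (term O l) (c *: vterm O t) (r *: term O w) -
    (alpha_term O l c * alpha_term O (l + t.2)%MM r) *: vterm O (tmul l t w)).
Proof.
have := below_inj_comp (i := t.1) (@monomial_mul _ _ _ _ ordT l c t.2 r w).
congr (below _ _ _ _); apply/ffunP => j; rewrite !ffunE.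
by case: eqP => _; rewrite ?scaler0 ?mulr0 ?mul0r ?subr0.
Qed.

(** A monomial of [f] has a term k < t, so its product only has terms up to l o k o w, which lies
    strictly below l o t o w. *)
Lemma below_bimul l t r w f : below (vterm O (m := m)) lt t f ->
  below (vterm O (m := m)) lt (tmul l t w) (bimul (term O l) f (r *: term O w)).
Proof.
move: f; apply: (coord_on_ind vterm_span (P := fun k => lt k t)
  (Q := fun f => below (vterm O (m := m)) lt (tmul l t w) (bimul (term O l) f (r *: term O w)))).
- by rewrite bimul0m; apply: below0 vterm_free vterm_span _ _.
- by move=> f g hf hg; rewrite bimulDm; apply: (belowD vterm_free vterm_span).
move=> c k _ /(@lt_tmul l _ _ w) kt.
have h := @vmonomial_mul l c k r w.
rewrite -(subrK ((alpha_term O l c * alpha_term O (l + k.2)%MM r) *: vterm O (tmul l k w))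
  (bimul _ _ _)).
apply: (belowD vterm_free vterm_span); first exact: (below_trans wo kt).
by apply: (belowZ vterm_free vterm_span); apply: (below_basis vterm_free vterm_span).
Qed.

Hypothesis domR : ring_domain R.

Lemma domain_neq0 (x y : R) : x <> 0 -> y <> 0 -> x * y <> 0.
Proof. by move=> x0 y0 /domR []. Qed.

(** The graded coefficient is a product of three nonzero factors, since [alpha_term] preserves being
    nonzero, and so it survives in a domain. The lower part of [g] stays below by [below_bimul]. *)
Lemma lead_bimul g c t (a b : R) l w :
  lead (vterm O (m := m)) lt g c t -> a <> 0 -> b <> 0 ->
  lead (vterm O (m := m)) lt (bimul (a *: term O l) g (b *: term O w))
    (a * alpha_term O l c * alpha_term O (l + t.2)%MM b) (tmul l t w).
Proof.
move=> [c0 gb] a0 b0; split.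
  by apply: (domain_neq0 (domain_neq0 a0 _) _); apply: alpha_term_neq0.
rewrite bimulZl -mulrA -scalerA -scalerBr; apply: (belowZ vterm_free vterm_span).
rewrite -[g](subrK (c *: vterm O t)) bimulDm -addrA; apply: (belowD vterm_free vterm_span).
  exact: below_bimul.
exact: vmonomial_mul.
Qed.

End OreModule.

(** * Finite sums of elements with a given property *)

Section SumOf.

Variables (T : Type) (V : zmodType) (val : T -> V).

(** Representations are families indexed by ordinals; this form allows structural induction on them,
    and [sum_ofP] translates. *)
Inductive sum_of (Q : T -> Prop) : V -> Prop :=
| sum_of_nil : sum_of Q 0
| sum_of_cons p f : Q p -> sum_of Q f -> sum_of Q (val p + f).

Definition ord_cons (mu : nat) (p0 : T) (p : 'I_mu -> T) (i : 'I_mu.+1) : T :=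
  oapp p p0 (unlift ord0 i).

Lemma ord_cons0 mu p0 (p : 'I_mu -> T) : ord_cons p0 p ord0 = p0.
Proof. by rewrite /ord_cons unlift_none. Qed.

Lemma ord_consS mu p0 (p : 'I_mu -> T) i : ord_cons p0 p (lift ord0 i) = p i.
Proof. by rewrite /ord_cons liftK. Qed.

Lemma sum_ord_cons mu p0 (p : 'I_mu -> T) :
  \sum_(i < mu.+1) val (ord_cons p0 p i) = val p0 + \sum_(i < mu) val (p i).
Proof.
by rewrite big_ord_recl ord_cons0; congr (_ + _); apply: eq_bigr => i _; rewrite ord_consS.
Qed.

Lemma sum_ofP (Q : T -> Prop) f : sum_of Q f <->
  exists mu (p : 'I_mu -> T), (forall i, Q (p i)) /\ f = \sum_(i < mu) val (p i).
Proof.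
split.
  elim=> {f} [|p0 f Qp0 _ [mu [p [Qp ->]]]].
    have p : 'I_0 -> T by case.
    by exists 0%N, p; split; [case | rewrite big_ord0].
  exists mu.+1, (ord_cons p0 p); rewrite sum_ord_cons; split=> // i.
  by case: (unliftP ord0 i) => [j|] ->; rewrite ?ord_consS ?ord_cons0.
case=> mu [p [Qp ->]]; elim: mu p Qp => [|mu IH] p Qp.
  by rewrite big_ord0; apply: sum_of_nil.
by rewrite big_ord_recl; apply: sum_of_cons => //; apply: IH.
Qed.

Lemma sum_of_mono (Q Q' : T -> Prop) f : (forall p, Q p -> Q' p) -> sum_of Q f -> sum_of Q' f.
Proof.
move=> QQ'; elim=> {f} [|p f Qp _ IH]; [exact: sum_of_nil | exact: sum_of_cons (QQ' _ Qp) IH].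
Qed.

Lemma sum_of1 (Q : T -> Prop) p : Q p -> sum_of Q (val p).
Proof. by move=> Qp; rewrite -[val p]addr0; apply: sum_of_cons => //; apply: sum_of_nil. Qed.

Lemma sum_ofD Q f g : sum_of Q f -> sum_of Q g -> sum_of Q (f + g).
Proof.
move=> Qf Qg; elim: Qf => {f} [|p f Qp _ IH]; first by rewrite add0r.
by rewrite -addrA; apply: sum_of_cons.
Qed.

Lemma sum_ofN (Q : T -> Prop) f : (forall p, Q p -> exists2 p', Q p' & val p' = - val p) ->
  sum_of Q f -> sum_of Q (- f).
Proof.
move=> QN; elim=> {f} [|p f /QN [p' Qp' pE] _ IH]; first by rewrite oppr0; apply: sum_of_nil.
by rewrite opprD -pE; apply: sum_of_cons.
Qed.

End SumOf.

(** * The ordering of terms with a least element adjoined *)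

Section OptionOrder.

Variables (K : eqType) (lt : rel K).
Hypothesis wo : well_ordering lt.

Lemma olt_trans x y z : olt lt x y -> olt lt y z -> olt lt x z.
Proof. case: x y z => [x|] [y|] [z|] //=; exact: (wo_trans wo). Qed.

Lemma ole_lt_trans x y z : ole lt x y -> olt lt y z -> olt lt x z.
Proof. by case/orP => [/eqP -> //|]; apply: olt_trans. Qed.

Lemma lt_ole_trans x y z : olt lt x y -> ole lt y z -> ole lt x z.
Proof. by move=> xy /orP[/eqP <-|yz]; apply/orP; right=> //; apply: olt_trans yz. Qed.

Lemma olt_ole x y : olt lt x y -> ole lt x y.
Proof. by move=> xy; apply/orP; right. Qed.

Lemma ole_refl x : ole lt x x.
Proof. by rewrite /ole eqxx. Qed.

End OptionOrder.

(** * Leading monomials of allowed products *)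

Section Groebner.

Variables (R : nzRingType) (n m : nat) (O : multiOre R n).
Variables (ltT : rel 'X_{1..n}) (lt : rel (mterm n m)) (s : setting) (F : vec O m -> Prop).
Hypotheses (domR : ring_domain R) (ordT : term_ordering ltT).
Hypotheses (ordM : compatible_ordering ltT lt) (F0 : ~ F 0).

Let wo := co_wo ordM.
Let vfree := @vterm_free R n O m.
Let vspan := @vterm_span R n O m.

Implicit Types (f g h : vec O m) (p : product O m) (t : mterm n m).

Notation leadV := (lead (vterm O (m := m)) lt).
Notation belowV := (below (vterm O (m := m)) lt).
Notation MT := (maxTV lt).
Notation allow := (allowed s F).

Lemma maxM_lead f u : maxM lt f = Some u <-> leadV f u.1 u.2.
Proof.
case: u => c t; rewrite /maxM; split=> /= [|l].
  case e: (MT f) => [t'|//] [<- <-]; exact: (max_term_lead vfree vspan wo e).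
by rewrite /maxTV (lead_max vfree vspan wo l) /= (lead_coord vfree vspan wo l).
Qed.

Lemma maxTV_lead f c t : leadV f c t -> MT f = Some t.
Proof. by move=> l; rewrite /maxTV (lead_max vfree vspan wo l). Qed.

Lemma lead_unique f c t c' t' : leadV f c t -> leadV f c' t' -> c = c' /\ t = t'.
Proof.
move=> l l'; have := maxTV_lead l; rewrite (maxTV_lead l') => -[e]; subst t'; split=> //.
by rewrite -(lead_coord vfree vspan wo l) (lead_coord vfree vspan wo l').
Qed.

Lemma maxTV_neq0 f : f <> 0 -> exists t c, leadV f c t /\ MT f = Some t.
Proof.
move=> /(lead_exists vfree vspan wo) [t e l].
by exists t, (coord_on (vterm O (m := m)) f t).
Qed.

Lemma lead_below f c t t' : leadV f c t -> lt t t' -> belowV t' f.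
Proof.
by move=> l tt'; apply/(max_term_below vfree vspan wo); rewrite (lead_max vfree vspan wo l).
Qed.

(** As 0 is not in F, [p_g p] has a leading monomial and [lead_bimul] applies, both with the given
    coefficients and with coefficients 1. Hence all notions of term of a product coincide. *)
Lemma allowed_lead p : allow p -> exists v, let u := gbimul O (p_a p, p_lam p) v (p_b p, p_rho p) in
  [/\ maxM lt (p_g p) = Some v, p_term lt p = Some u.2, p_maxT lt p = Some u.2
    & leadV (p_val p) u.1 u.2].
Proof.
move=> [Fg a0 b0 _].
have [|t [c [l e]]] := @maxTV_neq0 (p_g p); first by move=> g0; rewrite g0 in Fg.
exists (c, t); split=> /=.
- by apply/maxM_lead.
- by rewrite /p_term e.
- have one0 : (1 : R) <> 0 by apply/eqP/oner_neq0.
  have := lead_bimul ordT ordM domR (p_lam p) (p_rho p) l one0 one0.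
  by rewrite !scale1r; apply: maxTV_lead.
exact: (lead_bimul ordT ordM domR (p_lam p) (p_rho p) l a0 b0).
Qed.

(** Leading monomials being multiplicative, M(F) can be read off the values of the allowed
    products. *)
Lemma inMF_lead u : inMF lt s F u <->
  exists p, [/\ allow p, p_term lt p = Some u.2 & leadV (p_val p) u.1 u.2].
Proof.
split=> [[p [ap [v gv ->]]]|[p [ap pu lp]]].
  have [v' [gv' pt _ lp]] := allowed_lead ap.
  by move: gv'; rewrite gv => -[e]; subst v'; exists p.
have [v [gv _ _ lp']] := allowed_lead ap.
exists p; split=> //; exists v => //; case: u {pu} lp => c t /= lp.
by have [-> ->] := lead_unique lp lp'; rewrite -surjective_pairing.
Qed.

Lemma inMIMF_sum u : inMIMF lt s F u <->
  u.1 <> 0 /\ sum_of id (fun c => inMF lt s F (c, u.2)) u.1.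
Proof.
split=> -[u0 h]; split=> //; first by apply/sum_ofP.
exact: (proj1 (sum_ofP _ _ _) h).
Qed.

Lemma p_maxT_term p : allow p -> p_maxT lt p = p_term lt p.
Proof. by move=> /allowed_lead [v [_ -> -> _]]. Qed.

Lemma allowed_lead_term p : allow p -> exists c t, p_term lt p = Some t /\ leadV (p_val p) c t.
Proof. by move=> /allowed_lead [v [_ e _ l]]; do 2!eexists; split; [exact: e | exact: l]. Qed.

(** The sign is put on the left coefficient, except in the right setting, where that coefficient
    must stay 1 and the sign goes to the right one. *)
Lemma allowedN p : allow p ->
  exists2 p', allow p' & p_val p' = - p_val p.
Proof.
case: p => a l g b w [/= Fg a0 b0 hs].
have N0 (x : R) : x <> 0 -> - x <> 0 by move=> x0 /eqP; rewrite oppr_eq0 => /eqP.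
have aN : bimul ((- a) *: term O l) g (b *: term O w) =
    - bimul (a *: term O l) g (b *: term O w).
  by apply/ffunP => i; rewrite !ffunE scaleNr !mulNr.
have bN : bimul (a *: term O l) g ((- b) *: term O w) =
    - bimul (a *: term O l) g (b *: term O w).
  by apply/ffunP => i; rewrite !ffunE scaleNr !mulrN.
rewrite /allowed; case: s hs => hs.
- by exists (Product (- a) l g b w) => //=; split=> //=; apply: N0.
- by exists (Product a l g (- b) w) => //=; split=> //=; apply: N0.
- by exists (Product (- a) l g b w) => //=; split=> //=; apply: N0.
- by exists (Product (- a) l g b w) => //=; split=> //=; apply: N0.
Qed.

(** * Representations and single reduction steps *)

Notation sumP Q := (sum_of (@p_val R n O m) Q).

Lemma gen_sum f : gen s F f <-> sumP allow f.
Proof. by split=> [h|/sum_ofP //]; apply/sum_ofP. Qed.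

Lemma genB f g : gen s F f -> gen s F g -> gen s F (f - g).
Proof.
move=> /gen_sum hf /gen_sum hg; apply/gen_sum/sum_ofD => //.
apply: sum_ofN hg; exact: allowedN.
Qed.

Lemma genD f g : gen s F f -> gen s F g -> gen s F (f + g).
Proof. by move=> /gen_sum hf /gen_sum hg; apply/gen_sum/sum_ofD. Qed.

Lemma gen_p_val p : allow p -> gen s F (p_val p).
Proof. by move=> ap; apply/gen_sum/sum_of1. Qed.

Lemma gen0 : gen s F 0.
Proof. by apply/gen_sum; apply: sum_of_nil. Qed.

Definition allowed_le (o : option (mterm n m)) p := allow p /\ ole lt (p_term lt p) o.
Definition allowed_lt (o : option (mterm n m)) p := allow p /\ olt lt (p_term lt p) o.

Lemma weak_sum f : has_weak_repr lt s F f <-> sumP (allowed_le (MT f)) f.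
Proof.
split=> [[mu [p [[ap fE] hp]]]|/sum_ofP [mu [p [hp fE]]]].
  by apply/sum_ofP; exists mu, p; split=> // i; split.
exists mu, p; split; first by split=> // i; case: (hp i).
by move=> i; case: (hp i).
Qed.

Lemma strong_repr_cons f mu p0 (p : 'I_mu -> product O m) : allow p0 ->
  MT f = p_term lt p0 -> (forall i, allowed_lt (MT f) (p i)) ->
  f - p_val p0 = \sum_(i < mu) p_val (p i) -> strong_repr lt s F f (ord_cons p0 p).
Proof.
move=> ap0 ft hp fE; split.
- split=> [i|]; last by rewrite sum_ord_cons -fE addrC subrK.
  by case: (unliftP ord0 i) => [j|] ->; rewrite ?ord_consS ?ord_cons0 //; case: (hp j).
- by move=> i i0; have -> : i = ord0 by [apply: val_inj]; rewrite ord_cons0.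
move=> i; case: (unliftP ord0 i) => [j|] -> //; rewrite ord_consS => _.
by case: (hp j).
Qed.

Lemma strong_nil (p : 'I_0 -> product O m) : strong_repr lt s F 0 p.
Proof. by split=> [|[]|[]] //; split=> [[]|] //; rewrite big_ord0. Qed.

(** Splits off the leading product; zero, whose representation is empty, is listed apart. *)
Lemma strong_sum f : has_strong_repr lt s F f <-> f = 0 \/
  exists p, [/\ allow p, MT f = p_term lt p & sumP (allowed_lt (MT f)) (f - p_val p)].
Proof.
split=> [[[|mu] [p [[ap fE] h0 hS]]]|[->|[p0 [ap0 ft /sum_ofP [mu [p [hp fE]]]]]]].
- by left; rewrite fE big_ord0.
- right; exists (p ord0); split=> //; first exact: h0.
  apply/sum_ofP; exists mu, (fun i => p (lift ord0 i)); split=> [i|].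
    by split=> //; apply: hS.
  by rewrite fE big_ord_recl addrC addKr.
- have p : 'I_0 -> product O m by case.
  by exists 0%N, p; apply: strong_nil.
by exists mu.+1, (ord_cons p0 p); apply: strong_repr_cons.
Qed.

Lemma strong_weak f : has_strong_repr lt s F f -> has_weak_repr lt s F f.
Proof.
move=> /strong_sum [->|[p [ap fp h]]]; apply/weak_sum; first exact: sum_of_nil.
rewrite -{2}[f](subrK (p_val p)) addrC; apply: sum_of_cons.
  by rewrite fp; split=> //; apply: ole_refl.
by apply: sum_of_mono h => q [aq /olt_ole].
Qed.

Lemma weak_gen f : has_weak_repr lt s F f -> gen s F f.
Proof. by move=> /weak_sum h; apply/gen_sum; apply: sum_of_mono h => p []. Qed.

Lemma strong_gen f : has_strong_repr lt s F f -> gen s F f.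
Proof. by move=> /strong_weak /weak_gen. Qed.

(** Turns a weak representation of a remainder into the tail of a strong one: its terms are at most
    T(f), which is smaller than [t]. *)
Lemma weak_sum_below f t : has_weak_repr lt s F f -> belowV t f -> sumP (allowed_lt (Some t)) f.
Proof.
move=> /weak_sum h /(max_term_below vfree vspan wo) ft.
by apply: sum_of_mono h => p [ap pf]; split=> //; apply: ole_lt_trans ft.
Qed.

Lemma sum_below f t : sumP (allowed_lt (Some t)) f -> belowV t f.
Proof.
elim=> {f} [|p f [ap pt] _ IH]; first exact: below0 vfree vspan _ _.
apply: (belowD vfree vspan) => //.
have [c [t' [e l]]] := allowed_lead_term ap; rewrite e in pt.
exact: lead_below l pt.
Qed.

Lemma below_olt f t : belowV t f -> olt lt (MT f) (Some t).
Proof. by move/(max_term_below vfree vspan wo). Qed.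

Lemma maxV_ind (Q : vec O m -> Prop) : Q 0 ->
  (forall f c t, leadV f c t -> (forall g, belowV t g -> Q g) -> Q f) -> forall f, Q f.
Proof.
move=> Q0 QS; apply: (max_term_ind wo (b := vterm O (m := m))) => f IH.
case: (classic (f = 0)) => [-> //|/maxTV_neq0 [t [c [l e]]]].
by apply: (QS f c t l) => g /below_olt; rewrite -e; apply: IH.
Qed.

Lemma strong_step f c t : leadV f c t -> inMF lt s F (c, t) ->
  exists p, [/\ allow p, p_term lt p = Some t & belowV t (f - p_val p)].
Proof.
move=> l /inMF_lead [p [ap pt lp]]; exists p; split=> //.
exact: (lead_subr vfree vspan l lp).
Qed.

Definition allowed_eq t p := allow p /\ p_term lt p = Some t.

Lemma weak_step f c t : leadV f c t -> inMIMF lt s F (c, t) ->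
  exists2 g, sumP (allowed_eq t) g & belowV t (f - g).
Proof.
move=> [_ l] /inMIMF_sum [_ /= h].
(* The products realizing the summands of [c] are added up. Partial sums of the coefficients may
   vanish, hence a claim with [below] and not with [lead]. *)
have [g hg gt_] : exists2 g, sumP (allowed_eq t) g & belowV t (g - c *: vterm O t).
  elim: h => {c l} [|c d /inMF_lead [p [ap pt [_ lp]]] _ [g hg gb]].
    exists 0; first exact: sum_of_nil.
    by rewrite scale0r subrr; apply: below0 vfree vspan _ _.
  exists (p_val p + g); first by apply: sum_of_cons.
  by rewrite scalerDl opprD addrACA; apply: (belowD vfree vspan).
exists g => //; have := belowB vfree vspan l gt_; congr (below _ _ _ _).
by rewrite opprB addrA subrK.
Qed.

(** Products with term [t] contribute their leading coefficients to [c], the others lie below [t].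
    By cancellation [c] may be 0. *)
Lemma sum_weak_coef f t : sumP (allowed_le (Some t)) f ->
  exists2 c, sum_of id (fun c => inMF lt s F (c, t)) c & belowV t (f - c *: vterm O t).
Proof.
elim=> {f} [|p f [ap pt] _ [c hc fb]].
  exists 0; first exact: sum_of_nil.
  by rewrite scale0r subrr; apply: below0 vfree vspan _ _.
have [d [t' [e l]]] := allowed_lead_term ap; move: pt; rewrite e => /orP[/eqP[tE]|lt't].
  subst t'; exists (d + c); last first.
    by rewrite scalerDl opprD addrACA; apply: (belowD vfree vspan) => //; case: l.
  by apply: (sum_of_cons (val := id)) => //; apply/inMF_lead; exists p.
exists c => //; rewrite -addrA; apply: (belowD vfree vspan) => //.
exact: lead_below l lt't.
Qed.

Lemma sum_eq_gen f t : sumP (allowed_eq t) f -> gen s F f.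
Proof. by move=> h; apply/gen_sum; apply: sum_of_mono h => p []. Qed.

(** As [h] is below [t], [f - h] keeps the leading monomial of [f], and [p] can head its
    representation. The case [h = 0] represents [f] itself; the general one serves normal forms. *)
Lemma strong_repr_step f h c t p : leadV f c t -> allow p -> p_term lt p = Some t ->
  has_strong_repr lt s F (f - p_val p - h) -> belowV t (f - p_val p - h) -> belowV t h ->
  has_strong_repr lt s F (f - h).
Proof.
move=> l ap pt /strong_weak hw hb bh.
have lh : leadV (f - h) c t.
  apply: (leadD vfree vspan) => //; rewrite -scaleN1r; exact: (belowZ vfree vspan).
apply/strong_sum; right; exists p; rewrite (maxTV_lead lh); split=> //.
by rewrite addrAC; apply: weak_sum_below.
Qed.

Lemma weak_repr_step f h g c t : leadV f c t -> sumP (allowed_eq t) g ->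
  has_weak_repr lt s F (f - g - h) -> belowV t (f - g - h) -> belowV t h ->
  has_weak_repr lt s F (f - h).
Proof.
move=> l hg hw hb bh.
have lh : leadV (f - h) c t.
  apply: (leadD vfree vspan) => //; rewrite -scaleN1r; exact: (belowZ vfree vspan).
apply/weak_sum; rewrite (maxTV_lead lh).
rewrite -[f - h](subrK g); apply: sum_ofD.
  by rewrite addrAC; apply: sum_of_mono (weak_sum_below hw hb) => p [ap /olt_ole].
by apply: sum_of_mono hg => p [ap pt]; split=> //; rewrite pt; apply: ole_refl.
Qed.

(** * Existence of normal forms *)

Lemma strong_repr0 : has_strong_repr lt s F 0.
Proof. by apply/strong_sum; left. Qed.

Lemma weak_repr0 : has_weak_repr lt s F 0.
Proof. exact: strong_weak strong_repr0. Qed.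

Lemma lead_maxM_in P f c t : leadV f c t -> maxM_in lt P f <-> P (c, t).
Proof.
move=> l; split=> [[[c' t'] /maxM_lead l' h]|h]; first by have [-> ->] := lead_unique l l'.
by exists (c, t) => //; apply/maxM_lead.
Qed.

(** The bound on the terms of [h] strengthens the induction: it supplies the hypothesis on [h] in
    [strong_repr_step]. *)
Lemma strong_normal_form_exists f : exists2 h, strong_normal_form lt s F f h &
  forall t, belowV t f -> belowV t h.
Proof.
elim/maxV_ind: f => [|f c t l IH].
  exists 0 => //; split=> //; rewrite subrr; first exact: gen0.
  exact: strong_repr0.
case: (classic (inMF lt s F (c, t))) => [|nin]; last first.
  (* A leading monomial outside M(F) ends the reduction: [f] is its own normal form. *)
  exists f => //; split; last by move=> _ /(lead_maxM_in _ l).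
    by rewrite subrr; apply: gen0.
  by rewrite subrr; apply: strong_repr0.
move=> /(strong_step l) [p [ap pt pb]]; have [h [hg hr hn] hb] := IH _ pb.
have bh := hb t pb.
exists h; last first.
  move=> t' /below_olt; rewrite (maxTV_lead l) => tt'; exact: (below_trans wo tt').
split=> //; last first.
  exact: strong_repr_step l ap pt hr (belowB vfree vspan pb bh) bh.
by rewrite -[f](subrK (p_val p)) addrAC; apply: genD => //; apply: gen_p_val.
Qed.

Lemma weak_normal_form_exists f : exists2 h, weak_normal_form lt s F f h &
  forall t, belowV t f -> belowV t h.
Proof.
elim/maxV_ind: f => [|f c t l IH].
  exists 0 => //; split=> //; rewrite subrr; first exact: gen0.
  exact: weak_repr0.
case: (classic (inMIMF lt s F (c, t))) => [|nin]; last first.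
  exists f => //; split; last by move=> _ /(lead_maxM_in _ l).
    by rewrite subrr; apply: gen0.
  by rewrite subrr; apply: weak_repr0.
move=> /(weak_step l) [g hg pb]; have [h [hgen hr hn] hb] := IH _ pb.
have bh := hb t pb.
exists h; last first.
  move=> t' /below_olt; rewrite (maxTV_lead l) => tt'; exact: (below_trans wo tt').
split=> //; last first.
  exact: weak_repr_step l hg hr (belowB vfree vspan pb bh) bh.
by rewrite -[f](subrK g) addrAC; apply: genD => //; apply: sum_eq_gen hg.
Qed.

(** * Equivalence of basis properties and existence of representations *)

Definition strong_criterion := forall f, gen s F f -> has_strong_repr lt s F f.
Definition weak_criterion := forall f, gen s F f -> has_weak_repr lt s F f.

Lemma strong_basis_repr : strong_groebner_basis lt s F -> strong_criterion.
Proof.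
move=> B; apply: maxV_ind => [_|f c t l IH fg]; first exact: strong_repr0.
have /(lead_maxM_in _ l)/(strong_step l) [p [ap pt pb]] := B f fg (lead_neq0 vfree vspan wo l).
rewrite -[f]subr0; apply: (strong_repr_step l ap pt); rewrite ?subr0.
- by apply: (IH _ pb); apply: genB => //; apply: gen_p_val.
- exact: pb.
exact: below0 vfree vspan _ _.
Qed.

Lemma weak_basis_repr : weak_groebner_basis lt s F -> weak_criterion.
Proof.
move=> B; apply: maxV_ind => [_|f c t l IH fg]; first exact: weak_repr0.
have /(lead_maxM_in _ l)/(weak_step l) [g hg pb] := B f fg (lead_neq0 vfree vspan wo l).
rewrite -[f]subr0; apply: (weak_repr_step l hg); rewrite ?subr0.
- by apply: (IH _ pb); apply: genB => //; apply: sum_eq_gen hg.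
- exact: pb.
exact: below0 vfree vspan _ _.
Qed.

Lemma strong_repr_basis : strong_criterion -> strong_groebner_basis lt s F.
Proof.
move=> C f /C /strong_sum [-> //|[p [ap fp h]]] f0.
have [c [t [pt lp]]] := allowed_lead_term ap.
rewrite fp pt in h; have lf : leadV f c t.
  by rewrite -[f](subrK (p_val p)) addrC; apply: (leadD vfree vspan) => //; apply: sum_below.
by apply/(lead_maxM_in _ lf)/inMF_lead; exists p.
Qed.

Lemma weak_repr_basis : weak_criterion -> weak_groebner_basis lt s F.
Proof.
move=> C f /C /weak_sum h f0; have [t [c [l e]]] := maxTV_neq0 f0.
rewrite e in h; apply/(lead_maxM_in _ l)/inMIMF_sum => /=; split; first by case: l.
(* [d] collects the coefficients contributed at [t]; reading the coordinate at [t] identifies it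
   with the leading coefficient [c]. *)
have [d hd fb] := sum_weak_coef h; suff -> : c = d by [].
have := below_coord wo fb.
rewrite (coord_onB vfree vspan) (coord_onZ vfree vspan) (coord_on_basis vfree vspan).
by rewrite (lead_coord vfree vspan wo l) eqxx mulr1 => /eqP; rewrite subr_eq0 => /eqP.
Qed.

Lemma decreasing_strong f : has_decreasing_strong_repr lt s F f -> has_strong_repr lt s F f.
Proof. by case=> mu [p [h _ _]]; exists mu, p. Qed.

(** Only the head [p0] of a strong representation is kept: the remainder has a smaller maximal term,
    hence a decreasing representation by induction, and [p0] is put in front of it. *)
Lemma strong_decreasing : strong_criterion ->
  forall f, gen s F f -> has_decreasing_strong_repr lt s F f.
Proof.
move=> C; apply: maxV_ind => [_|f c t l IH fg].
  have p : 'I_0 -> product O m by case.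
  by exists 0%N, p; split; [exact: strong_nil | case | case].
have ft := maxTV_lead l.
have [f0|[p0 [ap0 fp0 /[1!ft] h]]] := (strong_sum f).1 (C f fg).
  by case: (lead_neq0 vfree vspan wo l).
have fb := sum_below h.
have [|mu [p [[[ap fE] hp0 hpS] hm0 hmS]]] := IH _ fb.
  by apply: genB => //; apply: gen_p_val.
have ple i : ole lt (p_term lt (p i)) (MT (f - p_val p0)).
  have [/hp0 ->|] := posnP i; [exact: ole_refl | by move/hpS/olt_ole].
have plt i : allowed_lt (MT f) (p i).
  by split=> //; rewrite ft; apply: ole_lt_trans (ple i) (below_olt fb).
exists mu.+1, (ord_cons p0 p); split; first exact: strong_repr_cons.
  by move=> i i0; have -> : i = ord0 by [apply: val_inj]; rewrite ord_cons0 p_maxT_term.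
move=> i j; case: (unliftP ord0 j) => [j'|] -> //; case: (unliftP ord0 i) => [i'|] ->.
  by rewrite !ord_consS; apply: hmS.
by rewrite ord_consS ord_cons0 !p_maxT_term // -fp0 => _; case: (plt j').
Qed.

Lemma inMF_inMIMF u : inMF lt s F u -> inMIMF lt s F u.
Proof.
move=> h; apply/inMIMF_sum; split; first by move/inMF_lead: h => [p [_ _ []]].
by apply: (@sum_of1 _ _ id); rewrite -surjective_pairing.
Qed.

Lemma skew_inMIMF_inMF : skew_field R -> (s = Right -> alphas_onto O) ->
  forall u, inMIMF lt s F u -> inMF lt s F u.
Proof.
move=> skew onto [d t] /inMIMF_sum [/= d0 hd].
(* Since [d] is nonzero the sum is not empty; one of its summands gives a product with term [t] to
   be rescaled. *)
have [c [p [[Fg a0 b0 hs] [v gv [_ ut]]]]] : exists c, inMF lt s F (c, t).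
  by case: hd d0 => [//|c e hc _ _]; exists c.
have v0 : v.1 <> 0 by move/maxM_lead: gv => [].
have [y [vy yv]] := skew _ (alpha_term_neq0 (O := O) (a := p_lam p) v0).
have one0 : (1 : R) <> 0 by apply/eqP/oner_neq0.
case: (classic (s = Right)) => [sR|nR].
  (* In the right setting [b] is adjusted: the endomorphism of the term to its left must send it to
     [y * d], which surjectivity allows. *)
  have [b' bE] := @alpha_term_onto _ _ _ (p_lam p + v.2.2)%MM (onto sR) (y * d).
  rewrite sR in hs; case: hs => a1 l0.
  exists (Product 1 (p_lam p) (p_g p) b' (p_rho p)); split.
    split=> //=; last by rewrite sR.
    move=> b'0; apply: d0; rewrite -[d]mul1r -vy -mulrA -bE b'0.
    by rewrite alpha_term0 mulr0.
  by exists v; rewrite // /gbimul /gmul /= bE mul1r mulrA vy mul1r ut.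
(* Otherwise [a] absorbs the correction, and [b] is set to 1, which every [alpha_term] fixes. *)
exists (Product (d * y) (p_lam p) (p_g p) 1 (p_rho p)); split.
  split=> //=; first by move=> dy0; apply: d0; rewrite -[d]mulr1 -yv mulrA dy0 mul0r.
  by case: s hs nR => [[_ ->]|_ /(_ erefl)|//|[-> _]].
by exists v; rewrite // /gbimul /gmul /= alpha_term1 mulr1 -mulrA yv mulr1 ut.
Qed.

End Groebner.

(** * One-sided Groebner representations and weak representations *)

Section OneSided.

Variables (R : nzRingType) (n m : nat) (O : multiOre R n).
Variables (ltT : rel 'X_{1..n}) (lt : rel (mterm n m)) (F : vec O m -> Prop).
Hypotheses (ordT : term_ordering ltT).
Hypotheses (ordM : compatible_ordering ltT lt) (F0 : ~ F 0).

Let wo := co_wo ordM.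
Let woT := to_wo ordT.
Let ofree := @term_free R n O.
Let ospan := @term_span R n O.

Let one_neq0 : (1 : R) <> 0.
Proof. exact/eqP/oner_neq0. Qed.

Lemma maxT_monomial (a : R) l : a <> 0 -> maxT ltT (a *: term O l) = Some l.
Proof.
move=> a0; apply: (lead_max ofree ospan woT (c := a)); split=> //.
by rewrite subrr; apply: below0 ofree ospan _ _.
Qed.

Lemma monomial_neq0 (a : R) l : a <> 0 -> a *: term O l <> 0.
Proof.
move=> a0 e; have := maxT_monomial l a0.
by rewrite e /maxT (max_term0 ofree ospan).
Qed.

Lemma tact_exists (x : O) g : F g -> x <> 0 -> exists w t,
  [/\ maxTV lt g = Some t, tact ltT lt x g = Some (tmul w t 0%MM) &
    forall k, coord_on (term O) x k <> 0 -> k = w \/ ltT k w].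
Proof.
move=> Fg x0.
have [|t [c [_ gt_]]] := maxTV_neq0 ordM (f := g); first by move=> g0; rewrite g0 in Fg.
have [w xw l] := lead_exists ofree ospan woT x0.
exists w, t; split=> //; first by rewrite /tact /maxT xw /= gt_.
by move=> k; apply: (lead_lt ofree ospan l).
Qed.

Lemma ole_tmul k w t o : k = w \/ ltT k w -> ole lt (Some (tmul w t 0%MM)) o ->
  ole lt (Some (tmul k t 0%MM)) o.
Proof.
case=> [-> //|/(co_mull ordM t) kw]; exact: (lt_ole_trans wo (y := Some _)).
Qed.

(** Expanding [x] into monomials yields allowed products; their terms [k] are at most T(x), so the
    bound on [tact] is inherited. *)
Lemma left_sum o (x : O) g : F g -> x <> 0 -> ole lt (tact ltT lt x g) o ->
  sum_of (@p_val R n O m) (allowed_le lt Left F o) (bimul x g 1).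
Proof.
move=> Fg x0; have [w [t [gt_ -> xw]]] := tact_exists Fg x0 => wo_.
move: x xw {x0}; apply: (coord_on_ind ospan (P := fun k => k = w \/ ltT k w)
  (Q := fun x => sum_of (@p_val R n O m) (allowed_le lt Left F o) (bimul x g 1))).
- by rewrite bimul0l; apply: sum_of_nil.
- by move=> x y hx hy; rewrite bimulDl; apply: sum_ofD.
move=> c k c0 kw.
have -> : bimul (c *: term O k) g 1 = p_val (Product c k g 1 0%MM).
  by rewrite /p_val /= term0 scale1r.
apply: sum_of1; split; first by split.
by rewrite /p_term /= gt_; apply: ole_tmul kw _.
Qed.

Lemma right_sum o (x : O) g : F g -> x <> 0 -> ole lt (tact ltT lt x g) o ->
  sum_of (@p_val R n O m) (allowed_le lt Right F o) (bimul 1 g x).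
Proof.
move=> Fg x0; have [w [t [gt_ -> xw]]] := tact_exists Fg x0 => wo_.
move: x xw {x0}; apply: (coord_on_ind ospan (P := fun k => k = w \/ ltT k w)
  (Q := fun x => sum_of (@p_val R n O m) (allowed_le lt Right F o) (bimul 1 g x))).
- by rewrite bimul0r; apply: sum_of_nil.
- by move=> x y hx hy; rewrite bimulDr; apply: sum_ofD.
move=> c k c0 kw.
have -> : bimul 1 g (c *: term O k) = p_val (Product 1 0%MM g c k).
  by rewrite /p_val /= term0 scale1r.
apply: sum_of1; split; first by split.
(* [tact] writes the cofactor on the left; terms commute, so this is also the term of the right
   product. *)
rewrite /p_term /= gt_ /=; have -> : tmul 0%MM t k = tmul k t 0%MM.
  by rewrite /tmul add0m addm0 addmC.
by apply: ole_tmul kw _.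
Qed.

Lemma sum_of_big (Q : product O m -> Prop) mu (f : 'I_mu -> vec O m) :
  (forall i, sum_of (@p_val R n O m) Q (f i)) ->
  sum_of (@p_val R n O m) Q (\sum_(i < mu) f i).
Proof.
move=> h; apply: (big_ind (sum_of (@p_val R n O m) Q)) => //; first exact: sum_of_nil.
exact: sum_ofD.
Qed.

Lemma left_groebner_weak f :
  has_left_groebner_repr ltT lt F f <-> has_weak_repr lt Left F f.
Proof.
split=> [[mu [l [g [Fl fE h]]]]|[mu [p [[ap fE] h]]]].
  apply/weak_sum; rewrite {2}fE; apply: sum_of_big => i.
  by have [Fg l0] := Fl i; apply: left_sum.
exists mu, (fun i => p_a (p i) *: term O (p_lam (p i))), (fun i => p_g (p i)); split.
- by move=> i; have [Fg a0 _ _] := ap i; split=> //; apply: monomial_neq0.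
- rewrite fE; apply: eq_bigr => i _; have [_ _ _ [b1 r0]] := ap i.
  by rewrite /p_val b1 r0 term0 scale1r.
move=> i; have [_ a0 _ [_ r0]] := ap i.
by rewrite /tact maxT_monomial //= -r0; apply: h.
Qed.

Lemma right_groebner_weak f :
  has_right_groebner_repr ltT lt F f <-> has_weak_repr lt Right F f.
Proof.
split=> [[mu [g [r [Fr fE h]]]]|[mu [p [[ap fE] h]]]].
  apply/weak_sum; rewrite {2}fE; apply: sum_of_big => i.
  by have [Fg r0] := Fr i; apply: right_sum.
exists mu, (fun i => p_g (p i)), (fun i => p_b (p i) *: term O (p_rho (p i))); split.
- by move=> i; have [Fg _ b0 _] := ap i; split=> //; apply: monomial_neq0.
- rewrite fE; apply: eq_bigr => i _; have [_ _ _ [a1 l0]] := ap i.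
  by rewrite /p_val a1 l0 term0 scale1r.
move=> i; have [_ _ b0 [_ l0]] := ap i.
rewrite /tact maxT_monomial //=; have := h i; rewrite /p_term l0.
by case: (maxTV lt (p_g (p i))) => //= t; rewrite /tmul add0m addm0 addmC.
Qed.

End OneSided.

(** * Implications between the eight conditions *)

Theorem proposition19 (R : nzRingType) (n m : nat) (O : multiOre R n)
    (ltT : rel 'X_{1..n}) (lt : rel (mterm n m))
    (s : setting) (F : vec O m -> Prop)
    (domR : ring_domain R)
    (ordT : term_ordering ltT)
    (ordM : compatible_ordering ltT lt)
    (F0 : ~ F 0) :
  let C1 := forall f, gen s F f <-> has_decreasing_strong_repr lt s F f in
  let C2 := forall f, gen s F f <-> has_strong_repr lt s F f in
  let C3 := strong_groebner_basis lt s F in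
  let C4 := forall f, gen s F f <-> has_weak_repr lt s F f in
  let C5 := weak_groebner_basis lt s F in
  let C6left := forall f, gen s F f <-> has_left_groebner_repr ltT lt F f in
  let C6right := forall f, gen s F f <-> has_right_groebner_repr ltT lt F f in
  let C7 := forall f h : vec O m, f <> 0 -> strong_normal_form lt s F f h ->
              (gen s F f <-> h = 0) in
  let C8 := forall f h : vec O m, f <> 0 -> weak_normal_form lt s F f h ->
              (gen s F f <-> h = 0) in
  (C1 <-> C2) /\ (C2 -> C4) /\
  (s = Left -> (C4 <-> C6left)) /\ (s = Right -> (C4 <-> C6right)) /\
  (C2 <-> C3) /\
  (C3 -> C7) /\ (C7 -> C2) /\
  (C3 -> C5) /\
  (C4 <-> C5) /\
  (C5 -> C8) /\ (C8 -> C4) /\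
  (skew_field R ->
     (s = Right -> alphas_onto O) ->
     (C4 -> C2) /\ (C5 -> C3)).
Proof.
move=> C1 C2 C3 C4 C5 C6left C6right C7 C8.
(* Every representable element lies in I(F), so what remains of the equivalence is the existence of
   representations. *)
have c2 : C2 <-> strong_criterion lt s F.
  by split=> h f; [move/h | split=> [/h //|/strong_gen]].
have c4 : C4 <-> weak_criterion lt s F.
  by split=> h f; [move/h | split=> [/h //|/weak_gen]].
have c23 : C2 <-> C3.
  split=> [/c2|h]; first exact: (strong_repr_basis domR ordT ordM F0).
  exact/c2/(strong_basis_repr domR ordT ordM F0).
have c45 : C4 <-> C5.
  split=> [/c4|h]; first exact: (weak_repr_basis domR ordT ordM F0).
  exact/c4/(weak_basis_repr domR ordT ordM F0).
have c35 : C3 -> C5.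
  move=> h f fg f0; have [u fu uF] := h f fg f0; exists u => //.
  exact: (inMF_inMIMF domR ordT ordM F0).
(* Shared core of [c37] and [c58]: [h = f - (f - h)] lies in I(F) when [f] does, and a nonzero such
   [h] will contradict the basis property. *)
have gen_sub f h : gen s F (f - h) -> (h <> 0 -> gen s F h -> False) ->
    (gen s F f <-> h = 0).
  move=> fh hh; split=> [fg|h0]; last by rewrite h0 subr0 in fh.
  apply: NNPP => /hh; apply; rewrite -[h](subKr f); exact: genB.
have c12 : C1 <-> C2.
  split=> h f; split=> [|fr].
  - by move/h/decreasing_strong.
  - exact: strong_gen fr.
  - by apply: (strong_decreasing domR ordT ordM F0); apply/c2.
  exact: strong_gen (decreasing_strong fr).
have c37 : C3 -> C7.
  by move=> h f g _ [fg _ gn]; apply: gen_sub => // g0 /h /(_ g0); apply: gn.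
have c58 : C5 -> C8.
  by move=> h f g _ [fg _ gn]; apply: gen_sub => // g0 /h /(_ g0); apply: gn.
(* The normal form obtained by reduction must be 0, so the representation of the difference is one
   of [f]. The case [f = 0] is apart, as [C7] speaks of nonzero [f]. *)
have c72 : C7 -> C2.
  move=> h; apply/c2 => f fg; case: (classic (f = 0)) => [->|f0]; first exact: strong_repr0.
  have [g gn _] := strong_normal_form_exists s domR ordT ordM F0 f.
  by have [_ + _] := gn; rewrite ((h f g f0 gn).1 fg) subr0.
have c84 : C8 -> C4.
  move=> h; apply/c4 => f fg; case: (classic (f = 0)) => [->|f0]; first exact: weak_repr0.
  have [g gn _] := weak_normal_form_exists s domR ordT ordM F0 f.
  by have [_ + _] := gn; rewrite ((h f g f0 gn).1 fg) subr0.
have c53 : skew_field R -> (s = Right -> alphas_onto O) -> C5 -> C3.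
  move=> sk onto h f fg f0; have [u fu uF] := h f fg f0; exists u => //.
  exact: (skew_inMIMF_inMF ordM sk onto).
split; first exact: c12.
split; first by move=> /c23/c35/c45.
split.
  by move=> sL; rewrite /C4 /C6left sL; split=> h f; rewrite h left_groebner_weak.
split.
  by move=> sR; rewrite /C4 /C6right sR; split=> h f; rewrite h right_groebner_weak.
do 7![split=> //].
by move=> sk onto; split; [move=> /c45/(c53 sk onto)/c23 | exact: c53].
Qed.
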